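(* Let $\frac{\pi}{3}<\alpha\le\frac{5\pi}{12}$, let $R^{\alpha}$ be a rhombus with side length $1$ and with an interior angle $\alpha$, let $\triangle$ be an equilateral triangle with a side parallel to a side (the base) of $R^{\alpha}$, and let $\{\triangle_n\}$ be a collection of homothetic copies of $\triangle$. If $$\sum A(\triangle_n)\ \ge\ \frac{\sqrt3}{4}\Big(1+\frac{2\sqrt3}{3}\sin\alpha\Big)^2,$$ then $\{\triangle_n\}$ permits a parallel covering of $R^{\alpha}$. Moreover, $$\varrho(R^{\alpha},\triangle)=\frac{\sqrt3\,(\sqrt3+2\sin\alpha)^2}{12\sin\alpha}.$$
   Context: $A(P)$ denotes the area of a planar convex body $P$. A collection $\{\triangle_n\}$ ($n=1,2,\ldots$) may be finite or infinite. Admissible rigid motions are translations and rotations of the plane (and their compositions). A collection $\{C_n\}$ of convex polygons permits a covering of a convex polygon $P$ if there exist admissible rigid motions $\sigma_n$, one for each $n$, such that $P\subseteq\bigcup_n\sigma_nC_n$. The covering is called parallel if there exists a side of $P$ (called a base of $P$) such that each $\sigma_nC_n$ has a side parallel to it. $\varrho(R^{\alpha},\triangle)$ is the smallest positive number such that any collection of homothetic copies of $\triangle$ with total area not less than $\varrho(R^{\alpha},\triangle)\cdot A(R^{\alpha})$ permits a parallel covering of $R^{\alpha}$. *)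

(* Defs.v *)
From HB Require Import structures.
From mathcomp Require Import all_boot all_order all_algebra.
From mathcomp Require Import all_classical all_reals all_analysis.
Import Order.TTheory GRing.Theory Num.Theory.
Import numFieldNormedType.Exports.

Set Implicit Arguments.
Unset Strict Implicit.
Unset Printing Implicit Defensive.

Local Open Scope classical_set_scope.
Local Open Scope ring_scope.

Section Plane.
Context {R : realType}.
Implicit Types (p q u v c : R * R) (P C D : set (R * R)).

Definition dot u v : R := u.1 * v.1 + u.2 * v.2.

(* The library norm on R * R is the sup norm, hence this one. *)
Definition enorm u : R := Num.sqrt (dot u u).

Definition angle u v : R := acos (dot u v / (enorm u * enorm v)).

Definition parallel u v : Prop := u.1 * v.2 = u.2 * v.1.

Definition area P : \bar R :=
  ((@lebesgue_measure R) \x (@lebesgue_measure R))%E P.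

Definition translation v p : R * R := p + v.

Definition rotation c (t : R) p : R * R :=
  c + (cos t * (p - c).1 - sin t * (p - c).2,
       sin t * (p - c).1 + cos t * (p - c).2).

Inductive rigid_motion : (R * R -> R * R) -> Prop :=
| rigid_translation v : rigid_motion (translation v)
| rigid_rotation c t : rigid_motion (rotation c t)
| rigid_comp f g : rigid_motion f -> rigid_motion g -> rigid_motion (f \o g).

Definition convex_hull C : set (R * R) :=
  smallest (fun A : set (R * R) => convex_set A) C.

(* [p, q] is a side of P when it is a nondegenerate segment cut out of P by a
   supporting line {x | dot u x = m}. *)
Definition is_side P p q : Prop :=
  p != q /\ exists u (m : R),
    [/\ u != 0, forall x, P x -> dot u x <= m &
        P `&` [set x | dot u x = m] = convex_hull [set p; q]].

Definition has_side_parallel_to P u : Prop :=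
  exists p q, is_side P p q /\ parallel (q - p) u.

Definition equilateral_triangle D : Prop :=
  exists p q r,
    [/\ p != q, enorm (q - p) = enorm (r - q), enorm (r - q) = enorm (p - r) &
        D = convex_hull [set p; q; r]].

Definition rhombus (s a : R) P : Prop :=
  exists p u v,
    [/\ enorm u = s, enorm v = s, angle u v = a &
        P = convex_hull [set p; p + u; p + u + v; p + v]].

Definition homothetic_copy D C : Prop :=
  exists (k : R) v, k != 0 /\ C = [set k *: p + v | p in D].

(* A finite or infinite collection is a family T restricted to an index set
   I : set nat; members may be repeated. *)
Definition homothetic_collection D (I : set nat) (T : nat -> set (R * R)) :=
  forall n, I n -> homothetic_copy D (T n).

(* Possibly +oo. *)
Definition total_area (I : set nat) (T : nat -> set (R * R)) : \bar R :=
  (\esum_(n in I) area (T n))%E.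

Definition permits_parallel_covering (I : set nat) (T : nat -> set (R * R)) P :=
  exists sigma : nat -> R * R -> R * R,
    [/\ forall n, I n -> rigid_motion (sigma n),
        P `<=` \bigcup_(n in I) (sigma n @` T n) &
        exists p q, is_side P p q /\
          forall n, I n -> has_side_parallel_to (sigma n @` T n) (q - p)].

Definition covering_ratios P D : set R :=
  [set r | 0 < r /\
     forall (I : set nat) (T : nat -> set (R * R)),
       homothetic_collection D I T ->
       (r%:E * area P <= total_area I T)%E ->
       permits_parallel_covering I T P].

(* rho(P, D) = r: the smallest element is required to exist. *)
Definition is_rho P D (r : R) : Prop :=
  covering_ratios P D r /\ lbound (covering_ratios P D) r.

End Plane.

(* Main.v *)
(* Put h = sin alpha, H = 2 h / sqrt 3 and L = 1 + H; the threshold is the area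
   of the equilateral triangle of side L, the smallest one with a side parallel
   to the base that contains the rhombus, hence the lower bound.

   For the covering, measure lengths so that a triangle of side s has height s;
   the rhombus has base 1 and height H. Triangles placed alternately upwards and
   downwards in a strip of height t cover a row of width w as soon as the sum of
   their n sides is at least w + (n + 1) t / 2, or w + (n / 2 + k) t when n is
   even, where k is the slope of the left side of the rhombus in these
   coordinates. Taking the triangles by decreasing size and closing each row when
   the next triangle would not make it higher, the area wasted by a row is paid
   by the decrease of the sizes: rows of width 1 cover the height h as soon as
   the sum of the squared sides is at least x + 2 h + 2 h x, where x bounds the
   sides. If all sides are at most H + 1/4, this leaves enough for a suitable
   first row of one, two or three triangles. A larger triangle with s < L is put
   in the lower left corner of the rhombus, and rows of decreasing width cover
   the missing upper right corner, of base L - s. Both cases leave some slack, so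
   an infinite collection may be replaced by a finite one. *)

Require Import Defs.
From mathcomp Require Import all_boot all_order all_algebra.
From mathcomp Require Import all_classical all_reals all_analysis.
From mathcomp Require Import measurable_realfun.
From mathcomp Require Import ring lra.
Import Order.TTheory GRing.Theory Num.Theory.
Import numFieldNormedType.Exports.

Set Implicit Arguments.
Unset Strict Implicit.
Unset Printing Implicit Defensive.

Local Open Scope classical_set_scope.
Local Open Scope ring_scope.

(** * Rows of triangles *)

(** By convexity the square lies below its chord over [[m, x]]; the chord is summed over [r]. *)
Lemma sumsq_le_chord (R : realFieldType) (x m : R) (r : seq R) :
  all (fun s => m <= s <= x) r ->
  \sum_(s <- r) s ^+ 2
    <= (size r)%:R * m ^+ 2 + (x + m) * (\sum_(s <- r) s - (size r)%:R * m).
Proof.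
elim: r => [|s r IH] /=; first by rewrite !big_nil; lra.
move=> /andP[/andP[ms sx] /IH]; rewrite !big_cons -natr1.
have : 0 <= (s - m) * (x - s) by rewrite mulr_ge0 ?subr_ge0.
lra.
Qed.

Lemma sumsq_le_mul (R : realFieldType) (x : R) (r : seq R) :
  all (fun s => 0 <= s <= x) r -> \sum_(s <- r) s ^+ 2 <= x * \sum_(s <- r) s.
Proof. by move=> /sumsq_le_chord /le_trans; apply; lra. Qed.

Lemma path_ge_all (R : realFieldType) (x y : R) (l : seq R) :
  path (fun a b => b <= a) x l -> x <= y -> all (fun s => s <= y) l.
Proof.
elim: l x => //= a l IH x /andP[ax pl] xy.
by have ay := le_trans ax xy; rewrite ay (IH a).
Qed.

(** The height [t] uses up the whole surplus of width, without being capped by the smallest side.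
    The chord over [[t, x]] gives the area bound with [t ^+ 2] to spare; the spare term lets a
    capped row satisfy the same bound. *)
Lemma uncapped_row (R : realFieldType) (e w x m : R) (r : seq R) :
  0 <= e <= 1 -> 0 <= w -> m <= x -> 0 < m ->
  all (fun s => m <= s <= x) r -> w < \sum_(s <- r) s ->
  2 * (\sum_(s <- r) s - w) <= ((size r)%:R + e) * m ->
  exists t : R, [/\ 0 < t <= m,
    ((size r)%:R + e) * t = 2 * (\sum_(s <- r) s - w) &
    \sum_(s <- r) s ^+ 2 <= w * (x + t) + (1 + e) * t ^+ 2].
Proof.
move=> e01 w0 mx m0 rmx wS Srm.
have n1 : 1 <= (size r)%:R :> R.
  by case: r wS {rmx Srm} => [|a r] /=; rewrite ?big_nil ?ler1n//; lra.
have ne0 : 0 < (size r)%:R + e by lra.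
have [t tE] : exists t, ((size r)%:R + e) * t = 2 * (\sum_(s <- r) s - w).
  exists (2 * (\sum_(s <- r) s - w) / ((size r)%:R + e)).
  by field; lra.
have t0 : 0 < t by rewrite -(pmulr_rgt0 _ ne0) tE; lra.
have tm : t <= m by rewrite -(ler_pM2l ne0) tE.
exists t; split; rewrite ?t0//.
have rtx : all (fun s => t <= s <= x) r.
  by apply/allP => s /(allP rmx) /andP[ms ->]; rewrite (le_trans tm ms).
apply: (le_trans (sumsq_le_chord rtx)).
set n := (size r)%:R in n1 tE *.
have -> : \sum_(s <- r) s = w + (n + e) * t / 2 by lra.
have : 0 <= (n - e) * t * (x - t) by rewrite !mulr_ge0//; lra.
have : 0 <= t ^+ 2 by rewrite sqr_ge0.
nra.
Qed.

(* A row stops as soon as the next triangle would be no taller than the height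
   [2 (S - w) / (n + e)] that the row already supports; it then either omits
   that triangle or, when the height would be capped by it, ends with it. *)
Lemma greedy_row_from (R : realFieldType) (e w x m : R) (q r : seq R) :
  0 <= e <= 1 -> 0 <= w -> m <= x -> 0 < m ->
  all (fun s => m <= s <= x) r ->
  path (fun a b => b <= a) m q -> all (fun s => 0 < s) q ->
  2 * (\sum_(s <- r) s - w) <= ((size r)%:R + e) * m ->
  w < \sum_(s <- r ++ q) s ->
  exists r' q' (t : R), [/\ r ++ q = r' ++ q', 0 < t <= x,
    w + ((size r')%:R + e) * t / 2 <= \sum_(s <- r') s,
    all (fun s => s <= t) q' && all (fun s => t <= s) r' &
    \sum_(s <- r') s ^+ 2 <= w * (x + t) + (1 + e) * t ^+ 2].
Proof.
move=> e01 w0; elim: q r m => [|l q IH] r m mx m0 rmx.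
  move=> _ _; rewrite cats0 => Srm wS.
  have [t [/andP[t0 tm] tE A]] := uncapped_row e01 w0 mx m0 rmx wS Srm.
  exists r, [::], t; split; rewrite ?cats0 //=.
  - by rewrite t0 (le_trans tm).
  - by rewrite tE; lra.
  - by apply/allP => s /(allP rmx) /andP[/(le_trans tm)].
move=> /= /andP[lm pq] /andP[l0 q0] Srm wS.
have [B|nB] := leP (w + ((size r)%:R + 1 + e) * l / 2) (\sum_(s <- r) s + l);
    last first.
  (* Even with [l] the row supports less than the height [l], so the invariant persists and the row
     goes on. *)
  have := IH (rcons r l) l; rewrite -!cats1 -!catA/=; apply => //.
  - by rewrite (le_trans lm).
  - rewrite all_cat/= lexx (le_trans lm mx) !andbT.
    by apply/allP => s /(allP rmx) /andP[ms ->]; rewrite (le_trans lm ms).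
  - by rewrite big_cat big_seq1 size_cat natrD /=; lra.
have [A|nA] := boolP ((w < \sum_(s <- r) s) &&
                      (((size r)%:R + e) * l <= 2 * (\sum_(s <- r) s - w))).
  move/andP : A => [A1 A2].
  have [t [/andP[t0 tm] tE A]] := uncapped_row e01 w0 mx m0 rmx A1 Srm.
  have ne0 : 0 < (size r)%:R + e.
    have n0 : 0 <= (size r)%:R :> R by rewrite ler0n.
    rewrite lt_neqAle eq_sym addr_ge0 ?andbT//; last by lra.
    by apply/eqP => ne0; move: tE; rewrite ne0 mul0r; lra.
  have lt : l <= t by rewrite -(ler_pM2l ne0) tE.
  exists r, (l :: q), t; split => //.
  - by rewrite t0 (le_trans tm).
  - by rewrite tE; lra.
  - rewrite /= lt (path_ge_all pq)//=.
    by apply/allP => s /(allP rmx) /andP[/(le_trans tm)].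
set n := (size r)%:R in B nA Srm.
have n0 : 0 <= n by rewrite /n ler0n.
have Sr : \sum_(s <- r) s <= w + (n + e) * l / 2.
  have nel : 0 <= (n + e) * l by rewrite mulr_ge0; lra.
  by move: nA; rewrite negb_and -!ltNge -leNgt => /orP[]; lra.
have rlx : all (fun s => l <= s <= x) r.
  by apply/allP => s /(allP rmx) /andP[ms ->]; rewrite (le_trans lm ms).
exists (rcons r l), q, l; split => //.
- by rewrite cat_rcons.
- by rewrite l0 (le_trans lm).
- by rewrite -cats1 big_cat big_seq1 size_cat natrD /= -/n; lra.
- rewrite (path_ge_all pq)//= all_rcons lexx/=.
  by apply/allP => s /(allP rlx) /andP[].
(* The closing triangle costs [l ^+ 2], the term that the uncapped estimate has to spare. An empty
   [r] is treated apart, since [n - e] may then be negative. *)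
rewrite -cats1 big_cat big_seq1 /=.
have lx : l <= x by lra.
have l2 : 0 <= l ^+ 2 by rewrite sqr_ge0.
have [r0|r0] := eqVneq r [::].
  have : 0 <= w * (x + l) by rewrite mulr_ge0//; lra.
  have : 0 <= e * l ^+ 2 by rewrite mulr_ge0//; lra.
  by rewrite r0 big_nil; lra.
have n1 : 1 <= n by rewrite /n ler1n lt0n size_eq0.
have := sumsq_le_chord rlx; rewrite -/n.
have : 0 <= (n - e) * l * (x - l) by rewrite !mulr_ge0//; lra.
have : 0 <= (x + l) * (w + (n + e) * l / 2 - \sum_(s <- r) s).
  by rewrite mulr_ge0//; lra.
nra.
Qed.

Lemma greedy_row (R : realFieldType) (e w x : R) (l : seq R) :
  0 <= e <= 1 -> 0 <= w -> 0 < x ->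
  path (fun a b => b <= a) x l -> all (fun s => 0 < s) l ->
  w < \sum_(s <- l) s ->
  exists r q (t : R), [/\ l = r ++ q, 0 < t <= x,
    w + ((size r)%:R + e) * t / 2 <= \sum_(s <- r) s,
    all (fun s => s <= t) q && all (fun s => t <= s) r &
    \sum_(s <- r) s ^+ 2 <= w * (x + t) + (1 + e) * t ^+ 2].
Proof.
move=> e01 w0 x0 pl l0 wS.
apply: (@greedy_row_from R e w x x l [::]) => //.
have : 0 <= e * x by rewrite mulr_ge0//; lra.
by rewrite big_nil /=; lra.
Qed.

(* [w0 + nu * h] is the width left when the height [h] remains to be covered;
   [e] is the loss at the ends of a row, in units of half its height. *)
Lemma greedy_rows (R : realFieldType) (e w0 nu : R)
    (C : R -> seq R -> Prop) (x h : R) (l : seq R) :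
  0 <= e <= 1 -> 0 <= w0 -> 0 <= nu -> 0 < w0 + nu ->
  (forall (h : R) l, h <= 0 -> C h l) ->
  (forall (h t : R) r q, 0 < h -> 0 < t ->
     w0 + nu * h + ((size r)%:R + e) * t / 2 <= \sum_(s <- r) s ->
     C (h - t) q -> C h (r ++ q)) ->
  0 < x -> path (fun a b => b <= a) x l -> all (fun s => 0 < s) l ->
  x * (w0 + nu * h) + 2 * w0 * h + nu * h ^+ 2 + (1 + e) * h * x
    <= \sum_(s <- l) s ^+ 2 ->
  C h l.
Proof.
move=> e01 w00 nu0 w0nu C0 C1.
have [n] := ubnP (size l); elim: n => // n IH in l x h * => ln x0 pl l0 hl.
have [h0|h0] := leP h 0; first exact: C0.
have wgt0 : 0 < w0 + nu * h.
  move: w00 nu0; rewrite !le_eqVlt => /predU1P[w_|w_] /predU1P[v_|v_].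
  - by move: w0nu; rewrite -w_ -v_ addr0 ltxx.
  - by rewrite -w_ add0r mulr_gt0.
  - by rewrite -v_ mul0r addr0.
  - by rewrite addr_gt0// mulr_gt0.
have w0h := ltW wgt0.
(* If the sides do not exceed one width, their squares sum to at most [x] times that width, which is
   too little. *)
have [Sw|wS] := leP (\sum_(s <- l) s) (w0 + nu * h).
  have l0x : all (fun s => 0 <= s <= x) l.
    have /allP lx := path_ge_all pl (lexx _).
    by apply/allP => s sl; rewrite lx// ltW// (allP l0).
  exfalso; have := sumsq_le_mul l0x.
  have : x * \sum_(s <- l) s <= x * (w0 + nu * h) by rewrite ler_pM2l.
  have : 0 <= (1 + e) * h * x by rewrite !mulr_ge0 ?ltW//; lra.
  have : 0 <= w0 * h by rewrite mulr_ge0// ltW.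
  have : 0 < (w0 + nu * h) * h by rewrite mulr_gt0.
  by lra.
have [r [q [t [lE /andP[t0 tx] rt /andP[qt _] Sr]]]] := greedy_row e01 w0h x0 pl l0 wS.
have sl : sorted (fun a b => b <= a) l by exact: path_sorted pl.
have /andP[_ q0] : all (fun s => 0 < s) r && all (fun s => 0 < s) q.
  by rewrite -all_cat -lE.
rewrite lE; apply: (C1 h t) => //.
apply: (IH _ t) => //.
- have r0 : (0 < size r)%N.
    case: r rt {lE Sr} => //=; rewrite big_nil add0r.
    have : 0 <= e * t by rewrite mulr_ge0 ?(ltW t0)//; lra.
    by lra.
  by rewrite -ltnS (leq_trans _ ln)// lE size_cat ltnS -[ltnLHS]add0n ltn_add2r.
- rewrite path_min_sorted//.
  by move: sl; rewrite lE => /cat_sorted2[].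
have hxt : 0 <= (1 + e) * h * (x - t) by rewrite !mulr_ge0//; lra.
move: hl; rewrite lE big_cat /=.
set A := \sum_(s <- r) _ in Sr *; set B := \sum_(s <- q) _ => hl.
rewrite -(lerD2l A); apply: le_trans hl.
(* The required amount telescopes: from [(x, h)] to [(t, h - t)] it drops by the area bound of the
   row plus the nonnegative term [(1 + e) * h * (x - t)]. *)
have -> : x * (w0 + nu * h) + 2 * w0 * h + nu * h ^+ 2 + (1 + e) * h * x =
  t * (w0 + nu * (h - t)) + 2 * w0 * (h - t) + nu * (h - t) ^+ 2
  + (1 + e) * (h - t) * t
  + ((w0 + nu * h) * (x + t) + (1 + e) * t ^+ 2 + (1 + e) * h * (x - t)).
  by ring.
by rewrite addrC lerD2l (le_trans Sr)// lerDl.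
Qed.

(* In these bounds, the left-hand side is the total area of a first row of height
   [t] plus the amount required by [greedy_rows] to cover the remaining height
   [H - t] when all remaining sides are at most [y]. *)
Lemma single_row_bound (R : realFieldType) (H x : R) :
  1 <= H <= 2231 / 2000 -> 1 <= x <= H + 1 / 4 ->
  x ^+ 2 + (x - 1 + 2 * (H - (x - 1)) * x) <= (1 + H) ^+ 2 - (H - 1) ^+ 2 / 100.
Proof.
move=> /andP[H1 Hu] /andP[x1 xH].
have : (3 / 4) ^+ 2 <= (H - (x - 1)) ^+ 2.
  by rewrite lerXn2r ?nnegrE; clear -xH; lra.
have : (H - 1) ^+ 2 <= 1 ^+ 2 by rewrite lerXn2r ?nnegrE; clear -H1 Hu; lra.
by clear -Hu xH; lra.
Qed.

(** Here [t = y = b]. The left side is a concave quadratic in [b] with maximum at [(2 * H - 1) / 2];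
    with [x = H + 1 / 4] the claim becomes [H ^+ 2 <= H / 2 + 11 / 16] up to the slack, which is
    nearly tight at [H = 2231 / 2000]. *)
Lemma capped_pair_row_bound (R : realFieldType) (H x b : R) :
  1 <= H <= 2231 / 2000 -> 0 <= x <= H + 1 / 4 ->
  x ^+ 2 + b ^+ 2 + (b + 2 * (H - b) * (1 + b))
    <= (1 + H) ^+ 2 - (H - 1) ^+ 2 / 100.
Proof.
move=> /andP[H1 Hu] /andP[x0 xH].
have : 0 <= (b - (2 * H - 1) / 2) ^+ 2 by rewrite sqr_ge0.
have : x ^+ 2 <= (H + 1 / 4) ^+ 2.
  by rewrite lerXn2r ?nnegrE//; clear -H1; lra.
have : (H - 1) ^+ 2 <= (231 / 2000) ^+ 2.
  by rewrite lerXn2r ?nnegrE; clear -H1 Hu; lra.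
have : H ^+ 2 <= H / 2 + 11 / 16 - 1 / 5000.
  have : 0 <= (2231 / 2000 - H) * (H - 1).
    by rewrite mulr_ge0 ?subr_ge0.
  by clear -Hu; lra.
by clear; lra.
Qed.

(** For a fixed sum, [x ^+ 2 + b ^+ 2] is largest when [b = y]. Since [y] lies between [t] and
    [(1 + k) * t], the terms in [y ^+ 2] and [t * y] can be eliminated. A quadratic in [t] remains,
    and its discriminant is not positive. *)
Lemma pair_row_bound (R : realFieldType) (k H x b t y : R) :
  0 <= k <= 67 / 250 -> 1 <= H <= 2231 / 2000 ->
  (1 + k) * t = x + b - 1 -> 0 <= t <= y -> y <= b <= x -> y <= (1 + k) * t ->
  x ^+ 2 + b ^+ 2 + (y + 2 * (H - t) * (1 + y))
    <= (1 + H) ^+ 2 - (H - 1) ^+ 2 / 100.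
Proof.
move=> /andP[k0 ku] /andP[H1 Hu] tE /andP[t0 ty] /andP[yb bx] ykt.
have xbE : x + b = 1 + (1 + k) * t by rewrite tE; clear; lra.
have E1 : x ^+ 2 + b ^+ 2 <= (x + b) ^+ 2 - 2 * y * (x + b) + 2 * y ^+ 2.
  have : 0 <= (b - y) * (x - y).
    by rewrite mulr_ge0 ?subr_ge0// (le_trans yb).
  by clear; lra.
rewrite xbE in E1.
have E2 : y ^+ 2 <= (2 + k) * t * y - (1 + k) * t ^+ 2.
  have : 0 <= (y - t) * ((1 + k) * t - y) by rewrite mulr_ge0 ?subr_ge0.
  by clear; lra.
have E3 : (2 * H - 1) * y <= (2 * H - 1) * ((1 + k) * t).
  by rewrite ler_wpM2l//; clear -H1; lra.
have s1 : (H - 1) ^+ 2 <= (231 / 2000) ^+ 2.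
  by rewrite lerXn2r ?nnegrE; clear -H1 Hu; lra.
have k2 : k ^+ 2 <= (67 / 250) ^+ 2.
  by rewrite lerXn2r ?nnegrE//; clear; lra.
have a0 : 0 < 1 - k ^+ 2 by clear -k2; lra.
pose bb := 2 * H - 1 + k * (1 + 2 * H).
have b0 : bb <= (2 * H - 1) + 67 / 250 * (1 + 2 * H).
  by rewrite /bb lerD2l ler_wpM2r//; clear -H1; lra.
have bge0 : 0 <= bb by rewrite /bb addr_ge0 ?mulr_ge0//; clear -H1; lra.
have bb2 : bb ^+ 2 <= ((2 * H - 1) + 67 / 250 * (1 + 2 * H)) ^+ 2.
  by rewrite lerXn2r ?nnegrE// (le_trans bge0).
have Hs : 0 <= H ^+ 2 - (H - 1) ^+ 2 / 100.
  have : 1 ^+ 2 <= H ^+ 2 by rewrite lerXn2r ?nnegrE ?ler01 ?(le_trans ler01).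
  by clear -s1; lra.
have disc : bb ^+ 2 <= 4 * ((1 - k ^+ 2) * (H ^+ 2 - (H - 1) ^+ 2 / 100)).
  have : (1 - (67 / 250) ^+ 2) * (H ^+ 2 - (H - 1) ^+ 2 / 100) <=
         (1 - k ^+ 2) * (H ^+ 2 - (H - 1) ^+ 2 / 100).
    by rewrite ler_wpM2r// lerD2l lerN2.
  have : 0 <= (2231 / 2000 - H) * (H - 1) by rewrite mulr_ge0 ?subr_ge0.
  by clear -bb2 Hu H1; lra.
have E4 : 0 <= (1 - k ^+ 2) * t ^+ 2 - bb * t + (H ^+ 2 - (H - 1) ^+ 2 / 100).
  rewrite -(pmulr_rge0 _ a0).
  by have := sqr_ge0 (2 * (1 - k ^+ 2) * t - bb); clear -disc; lra.
rewrite /bb in E4.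
by clear -E1 E2 E3 E4; lra.
Qed.

(** For a fixed sum the squares are largest when two sides equal [y], and [y] lies between [t] and
    [(1 + 2 * t) / 3]. All terms in [t] cancel, leaving at most [4 * H], which falls short of
    [(1 + H) ^+ 2] by [(H - 1) ^+ 2]. *)
Lemma triple_row_bound (R : realFieldType) (H x b l t y : R) :
  1 <= H -> 2 * t = x + b + l - 1 -> 0 <= t <= y -> y <= l -> l <= b <= x ->
  y <= 1 ->
  x ^+ 2 + b ^+ 2 + l ^+ 2 + (y + 2 * (H - t) * (1 + y))
    <= (1 + H) ^+ 2 - (H - 1) ^+ 2 / 100.
Proof.
move=> H1 tE /andP[t0 ty] yl /andP[lb bx] y1.
have yb := le_trans yl lb.
have yx := le_trans yb bx.
have SE : x + b + l = 1 + 2 * t by rewrite tE; clear; lra.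
have E1 : x ^+ 2 + b ^+ 2 + l ^+ 2 <=
    (x + b + l) ^+ 2 - 4 * (x + b + l) * y + 6 * y ^+ 2.
  have : 0 <= (x - y) * (b - y) by rewrite mulr_ge0 ?subr_ge0.
  have : 0 <= (x - y) * (l - y) by rewrite mulr_ge0 ?subr_ge0.
  have : 0 <= (b - y) * (l - y) by rewrite mulr_ge0 ?subr_ge0.
  by clear; lra.
have E2 : 3 * y ^+ 2 <= y * (1 + 2 * t + 3 * t) - t * (1 + 2 * t).
  have : 0 <= (y - t) * (1 + 2 * t - 3 * y).
    by rewrite mulr_ge0 ?subr_ge0// -SE; clear -yl yb yx; lra.
  by clear; lra.
rewrite SE in E1.
have E3 : (2 * H - 1) * y <= (2 * H - 1) * 1.
  by rewrite ler_wpM2l//; clear -H1; lra.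
have := sqr_ge0 (H - 1).
by clear -E1 E2 E3; lra.
Qed.

(** Starting the rows with a bound [x > 1] on the sides would require too much, so the first row is
    chosen by hand: [x] alone if its height [x - 1] is at least the next side, then the pair [x, b]
    if it supports the height [b] or reaches the third side, and otherwise three triangles. The case
    [x + b <= 1] is left to the greedy choice. *)
Lemma first_row (R : realFieldType) (k H : R) (C : R -> seq R -> Prop)
    (l : seq R) :
  0 <= k <= 67 / 250 -> 1 < H <= 2231 / 2000 ->
  (forall (h : R) l, h <= 0 -> C h l) ->
  (forall (h t : R) r q, 0 < h -> 0 < t ->
     1 + ((size r)%:R + 1) * t / 2 <= \sum_(s <- r) s ->
     C (h - t) q -> C h (r ++ q)) ->
  (forall (h t a b : R) q, 0 < h -> 0 < t -> 1 + (1 + k) * t <= a + b ->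
     C (h - t) q -> C h (a :: b :: q)) ->
  path (fun a b => b <= a) (H + 1 / 4) l -> all (fun s => 0 < s) l ->
  (1 + H) ^+ 2 - (H - 1) ^+ 2 / 100 <= \sum_(s <- l) s ^+ 2 ->
  C H l.
Proof.
move=> k1 H1 C0 C1 C2.
have H1' : 1 <= H <= 2231 / 2000 by lra.
have rest (y h : R) q : 0 < y -> all (fun s => 0 < s) q ->
    path (fun a b => b <= a) y q ->
    y + 2 * h * (1 + y) <= \sum_(s <- q) s ^+ 2 -> C h q.
  move=> y0 q0 pq hq.
  apply: (@greedy_rows _ 1 1 0 C y) => //; [by clear; rewrite ?addr0 ?lexx ?ler01 ?ltr01..| |].
    move=> {hq}h t r q' h0 t0 hr; apply: C1 => //; move: hr.
    by rewrite mul0r addr0.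
  by apply: le_trans hq; clear; lra.
have slack : 0 < (1 + H) ^+ 2 - (H - 1) ^+ 2 / 100 - (1 + 2 * H).
  have : 0 <= (H - 1) * (H - (H - 1) / 100).
    by rewrite mulr_ge0//; clear -H1'; lra.
  by clear -H1'; lra.
case: l => [|x l] /=.
  by move=> _ _; rewrite big_nil; clear -H1' slack; lra.
move=> /andP[xH pl] /andP[x0 l0]; rewrite big_cons => hS.
have [b1|b1] := leP (head 0 l) (x - 1).
  have [xb|xb] := leP (x + head 0 l) 1.
    case: l pl l0 hS b1 xb => [|b l] /=.
      rewrite big_nil => _ _ hS b1 xb; exfalso.
      have : x ^+ 2 <= 1 by rewrite exprn_ile1 ?(ltW x0)//; clear -xb; lra.
      by clear -hS H1' slack; lra.
    by move=> _ /andP[b0 _] _; clear -b0; lra.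
  have x1 : 1 < x.
    case: l {pl hS} l0 b1 xb => [|b l] /=; first by clear; lra.
    by move=> /andP[+ _]; clear; lra.
  apply: (C1 H (x - 1) [:: x] l) => //; rewrite ?big_seq1/=; [by clear -H1' x1; lra..|].
  apply: (rest (x - 1)) => //; [by clear -x1; lra| |].
    by case: l b1 pl {l0 hS xb} => //= b l -> /andP[].
  have : 1 <= x <= H + 1 / 4 by clear -x1 xH; lra.
  by move=> /(single_row_bound H1'); move: hS; clear; lra.
case: l pl l0 hS b1 => [|b l] /=.
  move=> _ _; rewrite big_nil => hS x1; exfalso.
  have : x ^+ 2 <= 1 by rewrite exprn_ile1 ?(ltW x0)//; clear -x1; lra.
  by clear -hS H1' slack; lra.
move=> /andP[bx pl] /andP[b0 l0]; rewrite big_cons => hS b1.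
have [xkb|xkb] := leP (k * b) (x - 1).
  apply: (C2 H b) => //; [by clear -H1' xkb; lra..|]; apply: (rest b) => //.
  have : 0 <= x <= H + 1 / 4 by rewrite (ltW x0).
  by move=> /(capped_pair_row_bound b H1'); move: hS; clear; lra.
have [xb1|xb1] := leP (x + b) 1.
  have Sl : 1 < \sum_(s <- [:: x, b & l]) s.
    rewrite ltNge; apply/negP => Sl.
    have l01 : all (fun s => 0 <= s <= 1) [:: x, b & l].
      have x1 : x <= 1 by clear -xb1 b0; lra.
      rewrite /= (ltW x0) (ltW b0) x1 (le_trans bx x1)/=.
      have /allP lb := path_ge_all pl (lexx _).
      by apply/allP => s sl; rewrite (ltW (allP l0 _ sl)) (le_trans (lb _ sl))// (le_trans bx).
    have := sumsq_le_mul l01.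
    rewrite !big_cons in Sl *.
    by clear -Sl hS H1' slack; lra.
  have w1 : 0 <= (1 : R) by [].
  have e1 : 0 <= (1 : R) <= 1 by rewrite w1 lexx.
  have pxbl : path (fun a b => b <= a) x [:: x, b & l] by rewrite /= lexx bx.
  have xbl0 : all (fun s => 0 < s) [:: x, b & l] by rewrite /= x0 b0.
  have [r [q [t [lE /andP[t0 tx] rt /andP[qt tr] Sr]]]] :=
    greedy_row e1 w1 x0 pxbl xbl0 Sl.
  (* As [x < 1], one triangle does not fill the row, so [b] belongs to it. Hence [t <= b <= 1 / 2],
     which keeps [2 * H * t] below [H]. *)
  have tb : t <= b.
    case: r lE rt tr {Sr} => [|r1 [|r2 r]] /=.
    - by rewrite big_nil => _; clear -t0; lra.
    - move=> [<- _]; by rewrite big_seq1; clear -t0 xb1 b0; lra.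
    - by move=> [_ <- _] _ /and3P[].
  rewrite lE; apply: (C1 H t) => //; [by clear -H1'; lra|].
  apply: (rest t) => //.
  - by move: xbl0; rewrite lE all_cat => /andP[].
  - rewrite path_min_sorted//.
    have : sorted (fun a b => b <= a) [:: x, b & l] by rewrite /= bx.
    by rewrite lE => /cat_sorted2[].
  have : x ^+ 2 + (b ^+ 2 + \sum_(s <- l) s ^+ 2) =
      \sum_(s <- r) s ^+ 2 + \sum_(s <- q) s ^+ 2.
    by rewrite -big_cat -lE !big_cons.
  have : 2 * H * t <= 2 * H * (1 / 2).
    by rewrite ler_wpM2l//; clear -H1' tb xb1 bx; lra.
  have : 0 <= (H - 1) * (H - (H - 1) / 100).
    by rewrite mulr_ge0//; clear -H1'; lra.
  by move: Sr hS; clear -xb1 b0; lra.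
have kp : 0 < 1 + k by clear -k1; lra.
have [t tE] : exists t, (1 + k) * t = x + b - 1.
  by exists ((x + b - 1) / (1 + k)); field; clear -k1; lra.
have t0 : 0 < t by rewrite -(pmulr_rgt0 _ kp) tE; clear -xb1; lra.
have tb : t <= b by rewrite -(ler_pM2l kp) tE; clear -xkb; lra.
have tkt : t <= (1 + k) * t.
  by rewrite mulrDl mul1r lerDl mulr_ge0 ?(ltW t0)//; clear -k1; lra.
have [l1|l1] := leP (head 0 l) (x + b - 1).
  apply: (C2 H t) => //; [by clear -H1' tE; lra..|].
  (* The remaining sides are at most [y]; the maximum with [t] ensures [t <= y], as the estimate
     requires. *)
  pose y := Num.max (head 0 l) t.
  have ty : t <= y by rewrite le_max lexx orbT.
  apply: (rest y) => //; first exact: lt_le_trans ty.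
    have : head 0 l <= y by rewrite le_max lexx.
    by move: (y) pl => z; case: (l) => //= c l' /andP[_ ->] ->.
  have yb : y <= b.
    rewrite ge_max tb andbT.
    by case: (l) pl => [|c l'] /=; [rewrite ltW|case/andP].
  have ykt : y <= (1 + k) * t by rewrite ge_max tkt andbT tE.
  have ty0 : 0 <= t <= y by rewrite (ltW t0).
  have ybx : y <= b <= x by rewrite yb.
  by have := pair_row_bound k1 H1' tE ty0 ybx ykt; move: hS; clear; lra.
case: l pl l0 hS l1 => [|c l] /=; first by clear -xb1; lra.
move=> /andP[cb pl] /andP[c0 l0]; rewrite big_cons => hS c1.
have [t' t'E] : exists t', 2 * t' = x + b + c - 1.
  by exists ((x + b + c - 1) / 2); clear; field.
apply: (C1 H t' [:: x; b; c] l) => //; rewrite ?big_cons ?big_nil/=;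
  [by clear -H1' xb1 c0 t'E; lra..|].
pose y := Num.max (head 0 l) t'.
have ty : t' <= y by rewrite le_max lexx orbT.
apply: (rest y) => //; first by apply: lt_le_trans ty; clear -xb1 c0 t'E; lra.
  have : head 0 l <= y by rewrite le_max lexx.
  by move: (y) pl => z; case: (l) => //= d l' /andP[_ ->] ->.
have yc : y <= c.
  rewrite ge_max; apply/andP; split; last by clear -c1 t'E; lra.
  by case: (l) pl => [|d l'] /=; [rewrite ltW|case/andP].
have ty0 : 0 <= t' <= y by rewrite ty andbT; clear -xb1 c0 t'E; lra.
have cbx : c <= b <= x by rewrite cb.
(* From [x + b - 1 < c <= b <= x] follows [c < 1]. *)
have y1 : y <= 1 by rewrite (le_trans yc)//; clear -c1 cb bx; lra.
have HH : 1 <= H by clear -H1'; lra.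
by have := triple_row_bound HH t'E ty0 yc cbx y1; move: hS; clear; lra.
Qed.

(** * Covering a parallelogram in affine coordinates *)

(* Equilateral triangles of side [s], in the affine coordinates where their sides
   have equations x = cst, y = cst and x + y = cst; [p] is the corner with a
   horizontal side and a side x = cst. *)
Definition tri (R : realFieldType) (up : bool) (p : R * R) (s : R) : set (R * R) :=
  if up then [set q | [/\ p.1 <= q.1, p.2 <= q.2 & q.1 + q.2 <= p.1 + p.2 + s]]
  else [set q | [/\ q.1 <= p.1, q.2 <= p.2 & p.1 + p.2 - s <= q.1 + q.2]].

(** Triangles are removed one by one, so that rows can be concatenated and the placements stay
    existential until the end. *)
Fixpoint coverable (R : realFieldType) (A : set (R * R)) (l : seq R) : Prop :=
  if l is s :: l' then exists up p, coverable (A `\` tri up p s) l' else A `<=` set0.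

Lemma coverable_sub (R : realFieldType) (A B : set (R * R)) (l : seq R) :
  A `<=` B -> coverable B l -> coverable A l.
Proof.
elim: l A B => [|s l IH] A B AB /=; first exact: subset_trans.
by move=> [up [p Bl]]; exists up, p; apply: IH Bl; exact: setSD.
Qed.

Lemma coverable0 (R : realFieldType) (l : seq R) : coverable set0 l.
Proof.
elim: l => //= s l IH; exists true, (0, 0).
by apply: coverable_sub IH; rewrite set0D.
Qed.

Lemma coverable_cat (R : realFieldType) (A B : set (R * R)) (r q : seq R) :
  coverable A r -> coverable B q -> coverable (A `|` B) (r ++ q).
Proof.
elim: r A => [|s r IH] A /=.
  by move=> A0; apply: coverable_sub => z [/A0|].
move=> [up [p Ar]] Bq; exists up, p; apply: coverable_sub (IH _ Ar Bq).
by move=> z [[Az|Bz] Tz]; [left|right].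
Qed.

(* In a strip [y, y + t], triangles of alternating orientations are placed side
   by side, the first one starting on the line [chain_front up q = a]; they reach
   the line [chain_front _ q = chain_end y t up a l]. *)
Definition chain_front (R : realFieldType) (up : bool) (q : R * R) : R :=
  if up then q.1 else q.1 + q.2.

Definition chain_end (R : realFieldType) (y t : R) (up : bool) (a : R)
    (l : seq R) : R :=
  a + \sum_(s <- l) s - (size l)%:R * t / 2 +
  (if odd (size l) then (if up then y + t / 2 else - (y + t / 2)) else 0).

(** An upward triangle leads from a line [x = cst] to a line [x + y = cst], and a downward one back.
    Two consecutive triangles together lose [t]; the parity term of [chain_end] converts between the
    two kinds of lines. *)
Lemma chain_end_cons (R : realFieldType) (y t : R) (up : bool) (a s : R) l :
  chain_end y t up a (s :: l) =
  chain_end y t (~~ up) (if up then a + y + s else a - (y + t) + s) l.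
Proof.
rewrite /chain_end big_cons /= -natr1.
by case: up; case: (odd (size l)) => /=; lra.
Qed.

Lemma chain_step (R : realFieldType) (y t : R) (up : bool) (a s : R) q :
  y <= q.2 <= y + t -> a <= chain_front up q ->
  ~ tri up (if up then (a, y) else (a - (y + t) + s, y + t)) s q ->
  (if up then a + y + s else a - (y + t) + s) < chain_front (~~ up) q.
Proof.
move=> yq aq Tq; rewrite ltNge; apply/negP => qa; apply: Tq.
by case: up aq qa => /= aq qa; split => /=; lra.
Qed.

(** A point of the strip missed by the first triangle lies strictly beyond its far side, so the
    region open on its starting line is the one preserved by the induction; for an empty chain it is
    empty. *)
Lemma coverable_chain (R : realFieldType) (y t : R) (up : bool) (a : R) l :
  coverable [set q | [/\ y <= q.2 <= y + t, a < chain_front up q &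
    chain_front (up (+) odd (size l)) q <= chain_end y t up a l]] l.
Proof.
elim: l up a => [|s l IH] up a /=.
  move=> q [_]; rewrite addbF /chain_end big_nil mul0r /= => aq.
  by rewrite leNgt; case/negP; lra.
exists up, (if up then (a, y) else (a - (y + t) + s, y + t)).
have := IH (~~ up) (if up then a + y + s else a - (y + t) + s).
apply: coverable_sub => q /= [[yq aq qe] Tq].
split => //; first exact: (chain_step yq (ltW aq)).
by move: qe; rewrite chain_end_cons addbN addNb.
Qed.

Lemma coverable_chain_closed (R : realFieldType) (y t : R) (up : bool) (a : R) l :
  (0 < size l)%N ->
  coverable [set q | [/\ y <= q.2 <= y + t, a <= chain_front up q &
    chain_front (up (+) odd (size l)) q <= chain_end y t up a l]] l.
Proof.
case: l => // s l _ /=.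
exists up, (if up then (a, y) else (a - (y + t) + s, y + t)).
have := coverable_chain y t (~~ up) (if up then a + y + s else a - (y + t) + s) l.
apply: coverable_sub => q /= [[yq aq qe] Tq].
split => //; first exact: (chain_step yq aq).
by move: qe; rewrite chain_end_cons addbN addNb.
Qed.

Definition parallelogram (R : realFieldType) (k H : R) : set (R * R) :=
  [set q | 0 <= q.2 <= H /\ - k * q.2 <= q.1 <= 1 - k * q.2].

(* Only the bottom side of the parallelogram itself is kept: this makes the
   region empty for [h <= 0], and rows cover closed strips anyway. *)
Definition top_part (R : realFieldType) (k H h : R) : set (R * R) :=
  [set q | [/\ H - h <= q.2 <= H, h < H -> H - h < q.2 &
               - k * q.2 <= q.1 <= 1 - k * q.2]].

(** The chain starts at the leftmost abscissa of the strip, attained at its top. An odd chain ends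
    on a line [x + y = cst] and must reach the top end of the right side; an even one ends on a line
    [x = cst] and must reach its bottom end. This gives the two losses. *)
Lemma top_part_row (R : realFieldType) (k H h t : R) (r q : seq R) :
  0 <= k <= 1 -> 0 < t ->
  1 + (if odd (size r) then ((size r)%:R + 1) / 2 else (size r)%:R / 2 + k) * t
    <= \sum_(s <- r) s ->
  coverable (top_part k H (h - t)) q -> coverable (top_part k H h) (r ++ q).
Proof.
move=> /andP[k0 k1] t0 rS qc.
have r0 : (0 < size r)%N.
  case: r rS => //=; rewrite big_nil mul0r add0r.
  have : 0 <= k * t by rewrite mulr_ge0// ltW.
  by clear; lra.
have := coverable_chain_closed (H - h) t true (- k * (H - h + t)) r0.
move=> /coverable_cat /(_ qc); apply: coverable_sub => -[x y].
rewrite /top_part/= => -[/andP[y1 y2] y3 /andP[x1 x2]].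
have [yt|yt] := leP y (H - h + t); [left|right].
  have k2 : 0 <= k * (H - h + t - y) by rewrite mulr_ge0//; clear -yt; lra.
  have k3 : 0 <= k * (y - (H - h)) by rewrite mulr_ge0//; clear -y1; lra.
  have k4 : 0 <= (1 - k) * (H - h + t - y).
    by rewrite mulr_ge0//; clear -yt k1; lra.
  split; rewrite ?y1 ?yt//; first by clear -k2 x1; lra.
  rewrite /chain_end; case: (odd (size r)) rS => /= rS.
    by clear -rS k4 x2; lra.
  by clear -rS k3 x2; lra.
by split; [rewrite y2 andbT; clear -yt; lra|clear -yt; lra|rewrite x1].
Qed.

(* The part of the parallelogram missed by an upward triangle placed in its
   lower left corner; [h] is its height. *)
Definition corner (R : realFieldType) (k b h : R) : set (R * R) :=
  [set q | [/\ (1 - k) * q.2 <= (1 - k) * h + (b - 1), b < q.1 + q.2 &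
               q.1 <= 1 - k * q.2]].

Lemma corner0 (R : realFieldType) (k b h : R) : 0 <= 1 - k -> h <= 0 ->
  corner k b h `<=` set0.
Proof.
move=> k1 h0 [x y] [/= y1 xy x1].
have : 0 <= (1 - k) * - h by rewrite mulr_ge0// oppr_ge0.
by clear -y1 xy x1; lra.
Qed.

(** The region is a triangle pointing downwards, of width [(1 - k) * h] at its top, and the row is
    laid along the top. It starts with a downward triangle against the line [x + y = b], so nothing
    is lost on the left. *)
Lemma corner_row (R : realFieldType) (k b h t : R) (r q : seq R) :
  0 <= k < 1 -> 0 < t ->
  (1 - k) * h +
  (if odd (size r) then ((size r)%:R - 1) / 2 + k else (size r)%:R / 2) * t
    <= \sum_(s <- r) s ->
  coverable (corner k b (h - t)) q -> coverable (corner k b h) (r ++ q).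
Proof.
move=> /andP[k0 k1] t0 rS qc.
have k1' : 0 < 1 - k by rewrite subr_gt0.
have [y1 y1E] : exists y1, (1 - k) * y1 = (1 - k) * h + (b - 1).
  by exists (((1 - k) * h + (b - 1)) / (1 - k)); field; clear -k1'; lra.
have := coverable_chain (y1 - t) t false b r.
move=> /coverable_cat /(_ qc); apply: coverable_sub => -[x y].
rewrite /corner/= -y1E ler_pM2l// => -[yy1 bxy x1].
have [yt|yt] := leP (y1 - t) y; [left|right].
  have k2 : 0 <= k * (y - (y1 - t)) by rewrite mulr_ge0//; clear -yt; lra.
  have k3 : 0 <= (1 - k) * (y1 - y) by rewrite mulr_ge0 ?(ltW k1')//; clear -yy1; lra.
  split => //; first by clear -yy1; lra.
  rewrite /chain_end; case: (odd (size r)) rS => /= rS.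
    by clear -rS k2 x1 y1E; lra.
  by clear -rS k3 x1 y1E; lra.
split => //.
have : (1 - k) * y <= (1 - k) * (y1 - t) by rewrite ler_pM2l// ltW.
by clear -y1E; lra.
Qed.

Lemma coverable_placement (R : realFieldType) (s : nat -> R) (A : set (R * R))
    (js : seq nat) :
  uniq js -> coverable A (map s js) ->
  exists pl : nat -> bool * (R * R), forall q, A q ->
    exists2 j, j \in js & tri (pl j).1 (pl j).2 (s j) q.
Proof.
elim: js A => [|j js IH] A /=.
  by move=> _ A0; exists (fun=> (true, (0, 0))) => q /A0.
move=> /andP[jjs ujs] [up [p Ac]].
have [pl plP] := IH _ ujs Ac.
exists (fun i => if i == j then (up, p) else pl i) => q Aq.
have [Tq|Tq] := pselect (tri up p (s j) q).
  by exists j; rewrite ?mem_head// eqxx.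
have [i ijs Ti] := plP q (conj Aq Tq).
exists i; first by rewrite inE ijs orbT.
by rewrite ifN//; apply: contraNneq jjs => <-.
Qed.

(** * Coverings of the whole parallelogram *)

Lemma rows_cover_parallelogram (R : realFieldType) (k H : R) (l : seq R) :
  0 <= k <= 67 / 250 -> 1 < H <= 2231 / 2000 ->
  path (fun a b => b <= a) (H + 1 / 4) l -> all (fun s => 0 < s) l ->
  (1 + H) ^+ 2 - (H - 1) ^+ 2 / 100 <= \sum_(s <- l) s ^+ 2 ->
  coverable (parallelogram k H) l.
Proof.
move=> k1 H1 pl l0 hl.
have k1' : 0 <= k <= 1 by clear -k1; lra.
suff : coverable (top_part k H H) l.
  apply: coverable_sub => q [q2 q1]; split => //; rewrite ?subrr//.
  by rewrite ltxx.
apply: (@first_row _ k H (fun h => coverable (top_part k H h))) => //.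
- move=> h l' h0; apply: coverable_sub (coverable0 l').
  move=> q [/andP[_ q2]]; have hH : h < H by clear -h0 H1; lra.
  by move=> /(_ hH); clear -h0 q2; lra.
- move=> h t r q h0 t0 rS; apply: top_part_row => //.
  apply: le_trans rS; case: ifP => _; first by rewrite mulrAC.
  rewrite lerD2l mulrAC ler_wpM2r ?(ltW t0)// mulrDl lerD2l.
  by clear -k1; lra.
- move=> h t a b q h0 t0 rS; apply: (@top_part_row _ k H h t [:: a; b]) => //=.
  by rewrite !big_cons big_nil addr0 divff ?pnatr_eq0.
Qed.

(** The side [x = - k * H] of the triangle passes through the upper left vertex, so only the points
    beyond its side [x + y = s - k * H] are missed. *)
Lemma corner_triangle_cover (R : realFieldType) (k H s : R) (l : seq R) :
  0 <= k ->
  coverable (corner k (s - k * H) ((1 + H - s) / (1 - k))) l ->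
  k < 1 -> coverable (parallelogram k H) (s :: l).
Proof.
move=> k0 lc k1; exists true, (- k * H, 0).
apply: coverable_sub lc => -[x y] [[/= /andP[y0 yH] /andP[x0 x1]] Tq].
have k1' : 0 < 1 - k by rewrite subr_gt0.
have kH : 0 <= k * (H - y) by rewrite mulr_ge0// subr_ge0.
have yk : (1 - k) * y <= (1 - k) * H by rewrite ler_pM2l.
rewrite /corner /=.
have -> : (1 - k) * ((1 + H - s) / (1 - k)) = 1 + H - s.
  by field; clear -k1'; lra.
split => /=; [by clear -yk; lra| |by clear -x1; lra].
rewrite ltNge; apply/negP => xy; apply: Tq; split => //=.
  by clear -x0 kH; lra.
by clear -xy; lra.
Qed.

(** Since [k <= 1 / 2], a row of [n] triangles in the corner loses at most [n * t / 2], so the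
    greedy rows apply with [e = 0], [w0 = 0] and [nu = 1 - k]. Here [x] is both the height of the
    corner and the bound on the sides. *)
Lemma corner_cover_parallelogram (R : realFieldType) (k H s : R) (l : seq R) :
  0 <= k <= 1 / 2 -> s < 1 + H ->
  let x := (1 + H - s) / (1 - k) in
  path (fun a b => b <= a) x l -> all (fun s => 0 < s) l ->
  2 * x * (1 + H - s) + x ^+ 2 <= \sum_(s <- l) s ^+ 2 ->
  coverable (parallelogram k H) (s :: l).
Proof.
move=> /andP[k0 k2] sH x pl l0 hl.
have k1' : 0 < 1 - k by clear -k2; lra.
have k1 : k < 1 by rewrite -subr_gt0.
apply: corner_triangle_cover => //.
have x0 : 0 < x by rewrite /x divr_gt0// subr_gt0.
have kx : (1 - k) * x = 1 + H - s by rewrite /x; field; clear -k1'; lra.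
rewrite -/x.
apply: (@greedy_rows _ 0 0 (1 - k) (fun h => coverable (corner k (s - k * H) h)) x) => //.
- by rewrite ler01 lexx.
- exact: ltW.
- by rewrite add0r.
- move=> h l' h0; apply: coverable_sub (coverable0 l').
  by apply: corner0 => //; exact: ltW.
- move=> h t r q h0 t0; rewrite add0r addr0 => rS.
  apply: (corner_row (t := t)) => //; rewrite ?k0//.
  apply: le_trans rS; rewrite lerD2l mulrAC ler_wpM2r ?(ltW t0)//.
  by case: ifP => _; clear -k2; lra.
rewrite -kx in hl; apply: le_trans hl; clear; lra.
Qed.

Lemma sort_family (R : realFieldType) (s : nat -> R) (x : R) (js : seq nat) :
  (forall j, j \in js -> s j <= x) ->
  exists2 js', perm_eq js' js & path (fun a b => b <= a) x (map s js').
Proof.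
move=> sx; pose js' := sort (fun i j => s j <= s i) js.
have pjs : perm_eq js' js by rewrite perm_sort.
exists js' => //; rewrite path_min_sorted.
  by rewrite sorted_map sort_sorted// => i j /=; rewrite le_total.
apply/allP => _ /mapP[j jjs ->]; apply: sx.
by rewrite -(perm_mem pjs).
Qed.

(** Three cases: one triangle contains everything, one is large enough for the corner method, or all
    sides are at most [H + 1 / 4]. The finite subfamily is extracted only after the case is known,
    as the admissible loss depends on it. *)
Lemma affine_cover (R : realFieldType) (k H : R) (I : set nat) (s : nat -> R) :
  0 <= k <= 67 / 250 -> 1 < H <= 2231 / 2000 ->
  3 * (2 - k) ^+ 2 < 8 * (1 - k) ^+ 2 * (1 + H) ->
  (forall n, I n -> 0 < s n) ->
  (forall e, 0 < e -> exists js : seq nat,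
     [/\ uniq js, forall j, j \in js -> I j &
         (1 + H) ^+ 2 - e <= \sum_(j <- js) s j ^+ 2]) ->
  exists pl : nat -> bool * (R * R), forall q, parallelogram k H q ->
    exists2 j, I j & tri (pl j).1 (pl j).2 (s j) q.
Proof.
move=> k1 H1 kH s0 hs.
have k12 : 0 <= k <= 1 / 2 by clear -k1; lra.
have /andP[k0 _] := k1.
have k1' : 0 < 1 - k by clear -k1; lra.
suff [js [ujs Ijs Pjs]] : exists js : seq nat, [/\ uniq js,
    forall j, j \in js -> I j & coverable (parallelogram k H) (map s js)].
  have [pl plP] := coverable_placement ujs Pjs.
  by exists pl => q /plP[j /Ijs Ij Tj]; exists j.
have [[n [In nH]]|noL] := pselect (exists n, I n /\ 1 + H <= s n).
  exists [:: n]; split => //; first by move=> j; rewrite inE => /eqP ->.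
  exists true, (- k * H, 0) => -[x y] [[/= /andP[y0 yH] /andP[x0 x1]]]; apply.
  split => //=.
    have : 0 <= k * (H - y) by rewrite mulr_ge0// subr_ge0.
    by clear -x0; lra.
  have : (1 - k) * y <= (1 - k) * H by rewrite ler_pM2l.
  by clear -x1 nH; lra.
have [[n [In nH]]|noC] := pselect (exists n, I n /\ H + 1 / 4 <= s n).
  have sH : s n < 1 + H.
    by rewrite ltNge; apply/negP => sH; apply: noL; exists n.
  set e := 1 + H - s n.
  have e0 : 0 < e by rewrite subr_gt0.
  have e34 : e <= 3 / 4 by rewrite /e; clear -nH; lra.
  have [x xE] : exists x, (1 - k) * x = e.
    by exists (e / (1 - k)); field; clear -k1'; lra.
  have xE' : x = (1 + H - s n) / (1 - k).
    by rewrite -/e -xE; field; clear -k1'; lra.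
  have x0 : 0 < x by rewrite xE' divr_gt0.
  (* A second triangle of side at least [x] covers the corner alone, as a row of one. *)
  have [[m [Im mn xm]]|nox] := pselect (exists m, [/\ I m, m != n & x <= s m]).
    exists [:: n; m]; split.
    - by rewrite /= inE eq_sym mn.
    - by move=> j; rewrite !inE => /orP[/eqP->|/eqP->].
    rewrite [map _ _]/=; apply: corner_triangle_cover => //; last by rewrite -subr_gt0.
    rewrite -xE'; apply: (@corner_row _ k _ x x [:: s m] [::]) => //=.
    - by rewrite k0 -subr_gt0.
    - by rewrite big_seq1 subrr mul0r add0r -mulrDl subrK mul1r.
    - by apply: corner0; rewrite ?subrr// ltW.
  (* The first product is [(1 + H) ^+ 2 - s n ^+ 2], the area left by the large triangle; the rest
     is what the corner requires. The hypothesis [kH] is this inequality at the extreme value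
     [e = 3 / 4]. *)
  have slack : 0 < e * (2 * (1 + H) - e) - (2 * x * e + x ^+ 2).
    rewrite -(pmulr_rgt0 _ (exprn_gt0 2 k1')).
    have -> : (1 - k) ^+ 2 * (e * (2 * (1 + H) - e) - (2 * x * e + x ^+ 2)) =
              e * (2 * (1 - k) ^+ 2 * (1 + H) - (2 - k) ^+ 2 * e).
      by rewrite -xE; ring.
    rewrite mulr_gt0// subr_gt0.
    have : (2 - k) ^+ 2 * e <= (2 - k) ^+ 2 * (3 / 4).
      by rewrite ler_wpM2l// sqr_ge0.
    by clear -kH; lra.
  have [js [ujs Ijs hjs]] := hs _ slack.
  have sjs j : j \in rem n js -> s j <= x.
    rewrite mem_rem_uniq// inE => /andP[jn jjs].
    rewrite leNgt; apply/negP => xj; apply: nox.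
    by exists j; split => //; [exact: Ijs|exact: ltW].
  have [js' pjs psjs] := sort_family sjs.
  exists (n :: js'); split.
  - rewrite /= (perm_uniq pjs) rem_uniq// andbT (perm_mem pjs).
    by rewrite mem_rem_uniq// inE eqxx.
  - move=> j; rewrite inE => /predU1P[->//|]; rewrite (perm_mem pjs).
    by move=> /mem_rem /Ijs.
  rewrite map_cons; apply: corner_cover_parallelogram => //; rewrite -?xE' ?xE//.
    apply/allP => _ /mapP[j + ->]; rewrite (perm_mem pjs) => /mem_rem /Ijs.
    exact: s0.
  (* The finite subfamily need not contain [n]; adding it to the front can only increase the sum. *)
  rewrite -/e big_map (perm_big _ pjs) /=.
  have : \sum_(j <- js) s j ^+ 2 <= s n ^+ 2 + \sum_(j <- rem n js) s j ^+ 2.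
    have [njs|njs] := boolP (n \in js).
      by rewrite (perm_big _ (perm_to_rem njs)) big_cons.
    by rewrite rem_id// lerDr sqr_ge0.
  have -> : s n = 1 + H - e by rewrite /e; clear; ring.
  by move: hjs; clear; lra.
have sH n : I n -> s n <= H + 1 / 4.
  move=> In; rewrite leNgt; apply/negP => nH; apply: noC.
  by exists n; split => //; exact: ltW.
have e0 : 0 < (H - 1) ^+ 2 / 100.
  by rewrite divr_gt0// exprn_gt0// subr_gt0; case/andP: H1.
have [js [ujs Ijs hjs]] := hs _ e0.
have [js' pjs psjs] := sort_family (fun j jjs => sH j (Ijs j jjs)).
exists js'; split.
- by rewrite (perm_uniq pjs).
- by move=> j; rewrite (perm_mem pjs) => /Ijs.
apply: rows_cover_parallelogram => //; last by rewrite big_map (perm_big _ pjs).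
by apply/allP => _ /mapP[j + ->]; rewrite (perm_mem pjs) => /Ijs /s0.
Qed.

(** * Areas of affine images *)

(** The pushforward scaled by [|e|] agrees with Lebesgue measure on the intervals []a, b]], hence
    everywhere. *)
Lemma lebesgue_measure_affine (R : realType) (c e : R) (B : set (measurableTypeR R)) :
  e != 0 -> measurable B ->
  lebesgue_measure ((fun y : R => c + e * y) @^-1` B) =
    ((`|e|^-1)%:E * lebesgue_measure B)%E.
Proof.
move=> e0 mB.
pose f : measurableTypeR R -> measurableTypeR R := fun y => c + e * y.
have mf : measurable_fun setT f.
  apply: measurable_funD; first exact: measurable_cst.
  by apply: measurable_funM => //; exact: measurable_cst.
suff -> : lebesgue_measure B = (`|e|%:E * pushforward lebesgue_measure f B)%E.
  rewrite muleA -EFinM mulVf ?normr_eq0// mul1e.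
  by [].
rewrite (@lebesgue_measure_unique _ (mscale `|e|%:nng (pushforward lebesgue_measure f)))//.
move=> _ [[a b]] _ <-.
transitivity (`|e|%:E * lebesgue_measure (f @^-1` `]a, b]))%E; last by [].
have [e_gt0|e_lt0|e_eq0] := ltrgt0P e; last by rewrite e_eq0 eqxx in e0.
  have -> : f @^-1` `]a, b] = `](a - c) / e, (b - c) / e]%classic.
    apply/seteqP; split => y; rewrite /f /= !in_itv/= ltr_pdivrMr// ler_pdivlMr//.
      by rewrite ltrBlDl lerBrDl [e * _]mulrC.
    by rewrite ltrBlDl lerBrDl [e * _]mulrC.
  rewrite !lebesgue_measure_itv /= !lte_fin ltr_pM2r ?invr_gt0// ltrD2r.
  case: ifPn => _; rewrite ?mule0// -!EFinB -EFinM; congr EFin.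
  by field.
have -> : f @^-1` `]a, b] = `[(b - c) / e, (a - c) / e[%classic.
  apply/seteqP; split => y; rewrite /f /= !in_itv/= ltr_ndivlMr// ler_ndivrMr//.
    by rewrite ltrBlDl lerBrDl [e * _]mulrC andbC.
  by rewrite ltrBlDl lerBrDl [e * _]mulrC andbC.
rewrite !lebesgue_measure_itv /= !lte_fin ltr_nM2r ?invr_lt0// ltrD2r.
case: ifPn => _; rewrite ?mule0// -!EFinB -EFinM; congr EFin.
by field.
Qed.

Lemma area_fiberwise (R : realType) (c k e : R) (X : set (R * R)) :
  e != 0 -> measurable (X : set (measurableTypeR R * measurableTypeR R)) ->
  area ((fun q => (q.1, c + k * q.1 + e * q.2)) @^-1` X) =
    ((`|e|^-1)%:E * area X)%E.
Proof.
move=> e0 mX; rewrite /area /product_measure1.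
under eq_integral => x _.
  rewrite /= (_ : xsection _ x =
    (fun y : R => c + k * x + e * y) @^-1` (xsection X x)); last first.
    by rewrite !xsectionE.
  rewrite lebesgue_measure_affine//; last exact: measurable_xsection.
  over.
by rewrite ge0_integralZl//; exact: measurable_fun_xsection.
Qed.

Lemma area_swap (R : realType) (X : set (R * R)) :
  measurable (X : set (measurableTypeR R * measurableTypeR R)) ->
  area (X : set (R * R)) = area ((fun q => (q.2, q.1)) @^-1` X).
Proof.
move=> mX.
transitivity ((lebesgue_measure \x^ lebesgue_measure)%E X).
  apply: product_measure_unique => // A B mA mB.
  exact: product_measure2E.
rewrite /area /product_measure1 /product_measure2; apply: eq_integral => x _ /=.
by rewrite xsectionE ysectionE.
Qed.

Definition aff (R : realType) (p a b q : R * R) : R * R := p + q.1 *: a + q.2 *: b.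

Definition det2 (R : realType) (a b : R * R) : R := a.1 * b.2 - a.2 * b.1.

Lemma measurable_aff (R : realType) (p a b : R * R) :
  measurable_fun setT (aff p a b :
    measurableTypeR R * measurableTypeR R -> measurableTypeR R * measurableTypeR R).
Proof.
have lin (c d e : R) : measurable_fun setT
    ((fun q => c + q.1 * d + q.2 * e) :
      measurableTypeR R * measurableTypeR R -> measurableTypeR R).
  apply: measurable_funD.
    apply: measurable_funD; first exact: measurable_cst.
    by apply: measurable_funM; [exact: measurable_fst|exact: measurable_cst].
  by apply: measurable_funM; [exact: measurable_snd|exact: measurable_cst].
by apply: measurable_fun_pair; exact: lin.
Qed.

Lemma measurable_preimage_aff (R : realType) (p a b : R * R) (X : set (R * R)) :
  measurable (X : set (measurableTypeR R * measurableTypeR R)) ->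
  measurable ((aff p a b @^-1` X) : set (measurableTypeR R * measurableTypeR R)).
Proof. by move=> mX; rewrite -[X in measurable X]setTI; exact: measurable_aff. Qed.

(** After exchanging [a] and [b] if needed, the map is a product of two maps that each change one
    coordinate only, with factors [a.1] and [det2 a b / a.1]; each is handled fibre by fibre. *)
Lemma area_aff_preimage (R : realType) (p a b : R * R) (X : set (R * R)) :
  det2 a b != 0 -> measurable (X : set (measurableTypeR R * measurableTypeR R)) ->
  area (aff p a b @^-1` X) = ((`|det2 a b|^-1)%:E * area X)%E.
Proof.
move=> + mX.
wlog a0 : a b / a.1 != 0 => [hw|] ab.
  have [a0|] := eqVneq a.1 0; last by move=> a0; apply: hw.
  have b0 : b.1 != 0.
    by apply: contraNneq ab => b0; rewrite /det2 a0 b0 mul0r mulr0 subrr.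
  rewrite area_swap; last exact: measurable_preimage_aff.
  have abC : det2 b a = - det2 a b by rewrite /det2; ring.
  have := hw b a b0; rewrite abC oppr_eq0 normrN => <- //.
  congr area; apply/funext => q.
  by rewrite /preimage /aff /= addrAC.
pose g1 (q : R * R) := aff (0, p.1) (1, b.1) (0, a.1) q.
pose g2 (q : R * R) :=
  aff (0, p.2 - a.2 / a.1 * p.1) (1, a.2 / a.1) (0, det2 a b / a.1) q.
have fib c k e (q : R * R) : aff (0, c) (1, k) (0, e) q = (q.1, c + k * q.1 + e * q.2).
  rewrite /aff [q in LHS]surjective_pairing /=; congr pair => /=.
    by rewrite add0r /GRing.scale/= mulr1 mulr0 addr0.
  by rewrite /GRing.scale/= [k * _]mulrC [e * _]mulrC.
pose sw (q : R * R) := (q.2, q.1).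
have fE q : aff p a b q = g2 (sw (g1 (sw q))).
  rewrite /g2 /g1 !fib /sw /= /aff [p in LHS]surjective_pairing /=.
  rewrite /det2; congr pair => /=; rewrite /GRing.scale/=; first by ring.
  by field.
have -> : aff p a b @^-1` X = sw @^-1` (g1 @^-1` (sw @^-1` (g2 @^-1` X))).
  by apply/funext => q; rewrite /preimage /= fE.
have msw Y : measurable (Y : set (measurableTypeR R * measurableTypeR R)) ->
    measurable (sw @^-1` Y : set (measurableTypeR R * measurableTypeR R)).
  move=> mY; rewrite -[X in measurable X]setTI; apply: (_ : measurable_fun setT _) => //.
  by apply: measurable_fun_pair; [exact: measurable_snd|exact: measurable_fst].
have mg2 : measurable (g2 @^-1` X : set (measurableTypeR R * measurableTypeR R)).
  exact: measurable_preimage_aff.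
rewrite -area_swap; last by apply: measurable_preimage_aff; exact: msw.
have -> : g1 = fun q => (q.1, p.1 + b.1 * q.1 + a.1 * q.2).
  by apply/funext => q; rewrite /g1 fib.
rewrite area_fiberwise//; last exact: msw.
rewrite -area_swap//.
have -> : g2 = fun q => (q.1, p.2 - a.2 / a.1 * p.1 + a.2 / a.1 * q.1 + det2 a b / a.1 * q.2).
  by apply/funext => q; rewrite /g2 fib.
rewrite area_fiberwise//; last by rewrite mulf_neq0// invr_eq0.
rewrite muleA -EFinM; congr (_%:E * _)%E.
by rewrite normrM normfV invfM invrK mulrCA mulVf ?mulr1 ?normr_eq0.
Qed.

Definition simplex2 {R : realType} : set (R * R) :=
  [set q | [/\ 0 <= q.1, 0 <= q.2 & q.1 + q.2 <= 1]].

Definition square2 {R : realType} : set (R * R) := `[0, 1] `*` `[0, 1].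

Lemma measurable_le_lin (R : realType) (a b c : R) :
  measurable ([set q | a * q.1 + b * q.2 <= c] :
    set (measurableTypeR R * measurableTypeR R)).
Proof.
have mf : measurable_fun setT ((fun q => a * q.1 + b * q.2) :
    measurableTypeR R * measurableTypeR R -> measurableTypeR R).
  apply: measurable_funD.
    by apply: measurable_funM; [exact: measurable_cst|exact: measurable_fst].
  by apply: measurable_funM; [exact: measurable_cst|exact: measurable_snd].
rewrite (_ : [set q | _] = (fun q : R * R => a * q.1 + b * q.2) @^-1` `]-oo, c]).
  by rewrite -[X in measurable X]setTI; apply: mf => //; exact: measurable_itv.
by apply/seteqP; split => q; rewrite /= in_itv.
Qed.

Lemma measurable_simplex2 (R : realType) :
  measurable (simplex2 : set (measurableTypeR R * measurableTypeR R)).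
Proof.
have -> : simplex2 = [set q : R * R | (-1) * q.1 + 0 * q.2 <= 0] `&`
   ([set q | 0 * q.1 + (-1) * q.2 <= 0] `&` [set q | 1 * q.1 + 1 * q.2 <= 1]).
  apply/seteqP; split => -[x y] /=;
    rewrite !mulN1r !mul0r !mul1r addr0 add0r !oppr_le0.
    by case.
  by case=> ? [].
by apply: measurableI; [|apply: measurableI]; exact: measurable_le_lin.
Qed.

Lemma measurable_square2 (R : realType) :
  measurable (square2 : set (measurableTypeR R * measurableTypeR R)).
Proof. by apply: measurableX; exact: measurable_itv. Qed.

Lemma area_square2 (R : realType) : area (@square2 R) = 1%:E.
Proof.
rewrite /area /square2 product_measure1E; try exact: measurable_itv.
by rewrite /= lebesgue_measure_itv/= lte_fin ltr01 -EFinB subr0 mule1.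
Qed.

Lemma area_simplex2 (R : realType) : area (@simplex2 R) = (1 / 2)%:E.
Proof.
pose B : set (R * R) := square2 `\` simplex2.
have mB : measurable (B : set (measurableTypeR R * measurableTypeR R)).
  by apply: measurableD; [exact: measurable_square2|exact: measurable_simplex2].
(* [B] is the reflected simplex deprived of its hypotenuse. *)
have BE : area B = area (@simplex2 R).
  have := @area_aff_preimage R (1, 1) (-1, 0) (0, -1) simplex2.
  rewrite /det2 /= mulr0 subr0 mulrNN mulr1 normr1 invr1 mul1e oner_eq0 => <- //; last exact: measurable_simplex2.
  rewrite /area /product_measure1; apply: eq_integral => x _ /=.
  have [x01|x01] := boolP (0 <= x <= 1); last first.
    rewrite (_ : xsection B x = set0); last first.
      rewrite xsectionE -subset0 => y [[/= + _] _].
      by rewrite in_itv/= (negbTE x01).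
    rewrite [X in _ = _ X](_ : _ = set0)// xsectionE -subset0 => y.
    rewrite /simplex2 /aff /= /GRing.scale/= !mulr0 !addr0 => -[x1 y1 xy1].
    by case/negP: x01; lra.
  have -> : xsection B x = `]1 - x, 1]%classic.
    rewrite xsectionE; apply/seteqP; split => y /=; rewrite /B /simplex2 /square2 /= !in_itv/=.
      move=> [[_ /andP[y0 ->]]] nxy; rewrite andbT ltNge; apply/negP => xy.
      by apply: nxy; split => //; lra.
    by move=> xy; split; [split => //; lra|move=> []; lra].
  rewrite xsectionE (_ : _ @^-1` _ = `[1 - x, 1]%classic); last first.
    apply/seteqP; split => y; rewrite /simplex2 /aff /= /GRing.scale/= in_itv/=.
      by move=> [x1 y1 xy1]; lra.
    by move=> xy; split; lra.
  by rewrite !lebesgue_measure_itv.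
have /eqP : area (@square2 R) = (area (@simplex2 R) + area (@simplex2 R))%E.
  rewrite -[X in (_ + X)%E]BE -measureU//=.
  - congr area; apply/seteqP; split => q.
      by have [s|s] := pselect (simplex2 q); [left|right].
    by case=> [[q1 q2 q12]|[//]]; split => /=; rewrite in_itv/=; lra.
  - exact: measurable_simplex2.
  - by rewrite /B setDE setICA setICr setI0.
rewrite area_square2.
by case: (area simplex2) => [r| |]//; rewrite -EFinD eqe => /eqP r1; congr EFin; lra.
Qed.

(** * Convex hulls and their sides *)

Lemma eq_pair (A B : Type) (p q : A * B) : p.1 = q.1 -> p.2 = q.2 -> p = q.
Proof. by case: p q => ? ? [? ?] /= -> ->. Qed.

Lemma convex_setP (R : realType) (A : set (R * R)) :
  convex_set A <->
  forall (t : R) p q, 0 <= t <= 1 -> A p -> A q -> A (t *: p + (1 - t) *: q).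
Proof.
split=> [cA t p q /andP[t0 t1] Ap Aq|cA p q t].
  by have := cA p q (Itv01 t0 t1); rewrite !inE; apply.
rewrite !inE => Ap Aq; apply: cA => //.
by rewrite ge0 le1.
Qed.

Definition affine_map (R : realType) (f : R * R -> R * R) :=
  forall (t : R) p q, f (t *: p + (1 - t) *: q) = t *: f p + (1 - t) *: f q.

Lemma convex_hull_convex (R : realType) (C : set (R * R)) :
  convex_set (convex_hull C).
Proof.
apply/convex_setP => t p q t01 Cp Cq A [cA CA].
by move/convex_setP : (cA); apply => //; [exact: Cp|exact: Cq].
Qed.

(** Both inclusions come from minimality of the hull: affine images and affine preimages of convex
    sets are convex. *)
Lemma convex_hull_image (R : realType) (f : R * R -> R * R) (C : set (R * R)) :
  affine_map f -> convex_hull (f @` C) = f @` convex_hull C.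
Proof.
move=> af; apply/seteqP; split.
  apply: smallest_sub; last by apply: image_subset; exact: sub_gen_smallest.
  apply/convex_setP => t _ _ t01 [p Cp <-] [q Cq <-].
  exists (t *: p + (1 - t) *: q); rewrite ?af//.
  by move/convex_setP : (@convex_hull_convex _ C); apply.
move=> _ [p Cp <-].
suff : (f @^-1` convex_hull (f @` C)) p by [].
apply: Cp; split => /=.
  apply/convex_setP => t p1 p2 t01 /= p1C p2C; rewrite /= af.
  by move/convex_setP : (@convex_hull_convex _ (f @` C)); apply.
by move=> q Cq; apply: sub_gen_smallest; exists q.
Qed.

Lemma affine_aff (R : realType) (p a b : R * R) : affine_map (aff p a b).
Proof.
by move=> t q1 q2; apply: eq_pair; rewrite /aff /= /GRing.scale/=; ring.
Qed.

Lemma convex_simplex2 (R : realType) : convex_set (@simplex2 R).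
Proof.
apply/convex_setP => t [x y] [x' y'] t01 [/= x0 y0 xy] [/= x0' y0' xy'].
have t0 : 0 <= t by case/andP: t01.
have t1 : 0 <= 1 - t by rewrite subr_ge0; case/andP: t01.
split; rewrite /= /GRing.scale/=; [by rewrite addr_ge0// mulr_ge0..|].
have : 0 <= t * (1 - (x + y)) by rewrite mulr_ge0// subr_ge0.
have : 0 <= (1 - t) * (1 - (x' + y')) by rewrite mulr_ge0// subr_ge0.
by clear; lra.
Qed.

Lemma convex_square2 (R : realType) : convex_set (@square2 R).
Proof.
apply/convex_setP => t [x y] [x' y'] t01 [] /=; rewrite !in_itv/=.
move=> /andP[x0 x1] /andP[y0 y1] [] /=; rewrite !in_itv/=.
move=> /andP[x0' x1'] /andP[y0' y1'].
have t0 : 0 <= t by case/andP: t01.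
have t1 : 0 <= 1 - t by rewrite subr_ge0; case/andP: t01.
split; rewrite /= in_itv/= /GRing.scale/=; apply/andP; split;
  rewrite ?addr_ge0 ?mulr_ge0//.
  have : 0 <= t * (1 - x) by rewrite mulr_ge0// subr_ge0.
  have : 0 <= (1 - t) * (1 - x') by rewrite mulr_ge0// subr_ge0.
  by clear; lra.
have : 0 <= t * (1 - y) by rewrite mulr_ge0// subr_ge0.
have : 0 <= (1 - t) * (1 - y') by rewrite mulr_ge0// subr_ge0.
by clear; lra.
Qed.

Lemma convex_hull3 (R : realType) (a b c : R * R) :
  convex_hull [set a; b; c] = aff a (b - a) (c - a) @` simplex2.
Proof.
have aE : aff a (b - a) (c - a) (0, 0) = a.
  by rewrite /aff /= !scale0r !addr0.
have bE : aff a (b - a) (c - a) (1, 0) = b.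
  by rewrite /aff /= scale0r scale1r addr0 addrC subrK.
have cE : aff a (b - a) (c - a) (0, 1) = c.
  by rewrite /aff /= scale0r scale1r addr0 addrC subrK.
have -> : [set a; b; c] = aff a (b - a) (c - a) @` [set (0, 0); (1, 0); (0, 1)].
  by rewrite !image_setU !image_set1 aE bE cE.
rewrite convex_hull_image; last exact: affine_aff.
congr image; apply/seteqP; split.
  apply: smallest_sub; first exact: convex_simplex2.
  by move=> q [[]|] ->; split => /=; rewrite ?addr0 ?add0r.
move=> [x y] [/= x0 y0 xy] A [/convex_setP cA CA].
have A0 : A (0, 0) by apply: CA; left; left.
have A1 : A (1, 0) by apply: CA; left; right.
have A2 : A (0, 1) by apply: CA; right.
have [xy0|xy0] := eqVneq (x + y) 0.
  have -> : x = 0 by apply/eqP; rewrite eq_le x0 -xy0 lerDl y0.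
  by have -> : y = 0 by apply/eqP; rewrite eq_le y0 -xy0 lerDr x0.
(* The point lies on the segment from the origin to [(x, y) / (x + y)], a point of the
   hypotenuse. *)
have s0 : 0 < x + y by rewrite lt_neqAle eq_sym xy0 addr_ge0.
have xs : 0 <= x / (x + y) <= 1.
  by rewrite divr_ge0 ?addr_ge0// ler_pdivrMr// mul1r lerDl.
have s01 : 0 <= x + y <= 1 by rewrite addr_ge0.
have := cA _ _ _ s01 (cA _ _ _ xs A1 A2) A0.
congr A; apply: eq_pair; rewrite /= /GRing.scale/=; field => //.
Qed.

Lemma convex_hull4 (R : realType) (p u v : R * R) :
  convex_hull [set p; p + u; p + u + v; p + v] = aff p u v @` square2.
Proof.
have -> : [set p; p + u; p + u + v; p + v] =
    aff p u v @` [set (0, 0); (1, 0); (1, 1); (0, 1)].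
  by rewrite !image_setU !image_set1 /aff /= !scale0r !scale1r !addr0.
rewrite convex_hull_image; last exact: affine_aff.
congr image; apply/seteqP; split.
  apply: smallest_sub; first exact: convex_square2.
  by move=> q [[[]|]|] ->; split => /=; rewrite in_itv/= ?lexx ?ler01.
move=> [x y] []; rewrite /= !in_itv/= => x01 y01 A [/convex_setP cA CA].
have A0 : A (0, 0) by apply: CA; left; left; left.
have A1 : A (1, 0) by apply: CA; left; left; right.
have A2 : A (1, 1) by apply: CA; left; right.
have A3 : A (0, 1) by apply: CA; right.
have := cA _ _ _ y01 (cA _ _ _ x01 A2 A3) (cA _ _ _ x01 A1 A0).
by congr A; apply: eq_pair; rewrite /= /GRing.scale/=; ring.
Qed.

(** * Directions of sides and the effect of homotheties and rigid motions *)

Lemma dot_ge0 (R : realType) (u : R * R) : 0 <= dot u u.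
Proof. by rewrite addr_ge0// -expr2 sqr_ge0. Qed.

Lemma dot_eq0 (R : realType) (u : R * R) : (dot u u == 0) = (u == 0).
Proof.
rewrite /dot -!expr2 paddr_eq0 ?sqr_ge0// !sqrf_eq0.
by apply/andP/eqP => [[/eqP u1 /eqP u2]|->//]; exact: eq_pair.
Qed.

Lemma dot_aff (R : realType) (n p a b q : R * R) :
  dot n (aff p a b q) = dot n p + q.1 * dot n a + q.2 * dot n b.
Proof. by rewrite /dot /aff /= /GRing.scale/=; ring. Qed.

Lemma parallel_sym (R : realType) (u v : R * R) : parallel u v -> parallel v u.
Proof. by rewrite /parallel => uv; rewrite [LHS]mulrC [RHS]mulrC uv. Qed.

Lemma parallel_trans (R : realType) (u v w : R * R) :
  v != 0 -> parallel u v -> parallel v w -> parallel u w.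
Proof.
rewrite /parallel => v0 uv vw.
have [v1|v1] := eqVneq v.1 0.
  have v2 : v.2 != 0.
    by apply: contra v0 => /eqP v2; apply/eqP; exact: eq_pair.
  apply: (mulfI v2); transitivity (u.1 * v.2 * w.2); first by ring.
  by rewrite uv -mulrA vw; ring.
apply: (mulfI v1); transitivity (u.1 * (v.1 * w.2)); first by ring.
by rewrite vw mulrA uv; ring.
Qed.

Lemma parallel_coord (R : realType) (p a b q1 q2 : R * R) :
  [/\ q1.1 = q2.1 -> parallel (aff p a b q2 - aff p a b q1) b,
      q1.2 = q2.2 -> parallel (aff p a b q2 - aff p a b q1) a &
      q1.1 + q1.2 = q2.1 + q2.2 -> parallel (aff p a b q2 - aff p a b q1) (b - a)].
Proof.
split=> E; rewrite /parallel /aff /= /GRing.scale/=.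
- by rewrite E; ring.
- by rewrite E; ring.
- have -> : q1.1 = q2.1 + q2.2 - q1.2 by rewrite -E addrK.
  by ring.
Qed.

Lemma side_ends (R : realType) (P : set (R * R)) (p q : R * R) :
  is_side P p q -> exists u (m : R), [/\ u != 0, forall x, P x -> dot u x <= m,
    P p /\ dot u p = m & P q /\ dot u q = m].
Proof.
move=> [_ [u [m [u0 um PE]]]]; exists u, m; split => //.
  have : (P `&` [set x | dot u x = m]) p.
    by rewrite PE; apply: sub_gen_smallest; left.
  by [].
have : (P `&` [set x | dot u x = m]) q.
  by rewrite PE; apply: sub_gen_smallest; right.
by [].
Qed.

Lemma det2_dot0 (R : realType) (n a b : R * R) :
  det2 a b != 0 -> dot n a = 0 -> dot n b = 0 -> n = 0.
Proof.
move=> ab; rewrite /dot => na nb.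
have n1 : n.1 * det2 a b = 0.
  transitivity (b.2 * (n.1 * a.1 + n.2 * a.2) - a.2 * (n.1 * b.1 + n.2 * b.2)).
    by rewrite /det2; ring.
  by rewrite na nb !mulr0 subr0.
have n2 : n.2 * det2 a b = 0.
  transitivity (a.1 * (n.1 * b.1 + n.2 * b.2) - b.1 * (n.1 * a.1 + n.2 * a.2)).
    by rewrite /det2; ring.
  by rewrite na nb !mulr0 subr0.
by apply: eq_pair; apply: (mulIf ab); rewrite ?n1 ?n2 mul0r.
Qed.

Lemma triangle_side (R : realType) (a u v p q : R * R) :
  det2 u v != 0 -> is_side (aff a u v @` simplex2) p q ->
  [\/ parallel (q - p) u, parallel (q - p) v | parallel (q - p) (v - u)].
Proof.
move=> uv /side_ends[n [m [n0 nm [[[x1 y1] S1 pE] pm] [[[x2 y2] S2 qE] qm]]]].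
have [P1 P2 P3] := parallel_coord a u v (x1, y1) (x2, y2).
have nS z : simplex2 z -> dot n a + z.1 * dot n u + z.2 * dot n v <= m.
  by move=> Sz; rewrite -dot_aff; apply: nm; exists z.
have := @nS (0, 0); have := @nS (1, 0); have := @nS (0, 1).
rewrite /simplex2 /= !mul0r !mul1r !addr0 !add0r !lexx !ler01.
move=> /(_ (And3 isT isT isT)) h1 /(_ (And3 isT isT isT)) h2 /(_ (And3 isT isT isT)) h3.
move: pm qm; rewrite -pE -qE !dot_aff /= => pm qm.
move: S1 S2 => [/= x10 y10 xy1] [/= x20 y20 xy2].
(* On the supporting line the barycentric mean of the three nonnegative vertex gaps vanishes, so
   each weighted gap does. A vertex with positive gap has weight zero at both ends, which makes the
   segment parallel to the opposite side. *)
have wt x y : 0 <= x -> 0 <= y -> x + y <= 1 ->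
    dot n a + x * dot n u + y * dot n v = m ->
    [/\ (1 - x - y) * (m - dot n a) = 0, x * (m - dot n a - dot n u) = 0 &
        y * (m - dot n a - dot n v) = 0].
  move=> x0 y0 xy E.
  have k1 : 0 <= (1 - x - y) * (m - dot n a).
    by rewrite mulr_ge0 ?subr_ge0//; clear -xy; lra.
  have k2 : 0 <= x * (m - dot n a - dot n u).
    by rewrite mulr_ge0//; clear -h2; lra.
  have k3 : 0 <= y * (m - dot n a - dot n v).
    by rewrite mulr_ge0//; clear -h1; lra.
  have k0 : (1 - x - y) * (m - dot n a) + x * (m - dot n a - dot n u) +
            y * (m - dot n a - dot n v) = 0 by rewrite -E; ring.
  by clear -k0 k1 k2 k3; split; lra.
have [a1 b1 c1] := wt _ _ x10 y10 xy1 pm.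
have [a2 b2 c2] := wt _ _ x20 y20 xy2 qm.
have cancel0 (x y z : R) : z != 0 -> x * z = 0 -> y * z = 0 -> x = y.
  by move=> z0 xz yz; apply: (mulIf z0); rewrite xz yz.
have [ma|ma] := eqVneq (m - dot n a) 0; last first.
  apply: Or33. apply: P3 => /=.
  have := cancel0 _ _ _ ma a1 a2; clear; lra.
have [mu|mu] := eqVneq (m - dot n a - dot n u) 0; last first.
  by apply: Or32; apply: P1; exact: (cancel0 _ _ _ mu).
have [mv|mv] := eqVneq (m - dot n a - dot n v) 0; last first.
  by apply: Or31; apply: P2; exact: (cancel0 _ _ _ mv).
case/eqP: n0; apply: (det2_dot0 uv).
  by move/eqP: mu; rewrite ma sub0r oppr_eq0 => /eqP.
by move/eqP: mv; rewrite ma sub0r oppr_eq0 => /eqP.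
Qed.

Lemma parallelogram_side (R : realType) (a u v p q : R * R) :
  det2 u v != 0 -> is_side (aff a u v @` square2) p q ->
  parallel (q - p) u \/ parallel (q - p) v.
Proof.
move=> uv /side_ends[n [m [n0 nm [[[x1 y1] S1 pE] pm] [[[x2 y2] S2 qE] qm]]]].
have [P1 P2 _] := parallel_coord a u v (x1, y1) (x2, y2).
have nS x y : 0 <= x <= 1 -> 0 <= y <= 1 ->
    dot n a + x * dot n u + y * dot n v <= m.
  move=> x01 y01; have := dot_aff n a u v (x, y) => /= <-; apply: nm.
  by exists (x, y) => //; split; rewrite /= in_itv.
move: pm qm; rewrite -pE -qE !dot_aff /= => pm qm.
move: S1 S2 => [/= ] ; rewrite !in_itv/= => x1_ y1_ [/=].
rewrite !in_itv/= => x2_ y2_.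
have i0 : 0 <= (0 : R) <= 1 by rewrite lexx ler01.
have i1 : 0 <= (1 : R) <= 1 by rewrite lexx ler01.
(* A coordinate on which the support functional really depends is forced to the same end of [[0, 1]]
   at both points. *)
have ends (z e : R) : 0 <= z <= 1 -> e != 0 -> 0 <= z * e -> (1 - z) * e <= 0 ->
    z = if 0 < e then 1 else 0.
  move=> /andP[z0 z1]; case: ltgtP => // e0 _ ze ze1; apply/eqP; rewrite eq_le.
    by rewrite z1 -subr_le0 -(pmulr_lle0 _ e0).
  by rewrite z0 andbT -(nmulr_lge0 _ e0).
have [nv|nv] := eqVneq (dot n v) 0; last first.
  left; apply: P2 => /=; rewrite (@ends y1 (dot n v)) 1?(@ends y2 (dot n v))//.
  - by have := nS _ _ x2_ i0; rewrite mul0r addr0; clear -qm; lra.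
  - by have := nS _ _ x2_ i1; rewrite mul1r; clear -qm; lra.
  - by have := nS _ _ x1_ i0; rewrite mul0r addr0; clear -pm; lra.
  - by have := nS _ _ x1_ i1; rewrite mul1r; clear -pm; lra.
have [nu|nu] := eqVneq (dot n u) 0; last first.
  right; apply: P1 => /=; rewrite (@ends x1 (dot n u)) 1?(@ends x2 (dot n u))//.
  - by have := nS _ _ i0 y2_; rewrite mul0r addr0; clear -qm; lra.
  - by have := nS _ _ i1 y2_; rewrite mul1r; clear -qm; lra.
  - by have := nS _ _ i0 y1_; rewrite mul0r addr0; clear -pm; lra.
  - by have := nS _ _ i1 y1_; rewrite mul1r; clear -pm; lra.
by case/eqP: n0; exact: (det2_dot0 uv).
Qed.

Lemma is_side_homothety (R : realType) (P : set (R * R)) (p q w : R * R) (l : R) :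
  l != 0 -> is_side P p q ->
  is_side ((fun x => l *: x + w) @` P) (l *: p + w) (l *: q + w).
Proof.
move=> l0 [pq [u [m [u0 um PE]]]].
have lI : injective (fun x => l *: x + w).
  by move=> x y /addIr /(scalerI l0).
split; first by rewrite (inj_eq lI).
(* Scaling the normal by [l] too makes the factor [l ^+ 2] positive even for negative [l]. *)
have dE x : dot (l *: u) (l *: x + w) = l ^+ 2 * dot u x + l * dot u w.
  by rewrite /dot /= /GRing.scale/=; ring.
exists (l *: u), (l ^+ 2 * m + l * dot u w); split.
- by rewrite scaler_eq0 (negbTE l0).
- move=> _ [x Px <-]; rewrite dE lerD2r ler_wpM2l ?sqr_ge0//; exact: um.
- have -> : [set l *: p + w; l *: q + w] = (fun x => l *: x + w) @` [set p; q].
    by rewrite image_setU !image_set1.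
  rewrite convex_hull_image -?PE; last first.
    by move=> t x y; apply: eq_pair; rewrite /= /GRing.scale/=; ring.
  apply/seteqP; split => [_ [[x Px <-]]|_ [x [Px /= xm] <-]] /=.
    rewrite dE => /addIr /mulfI xm; exists x => //; split => //.
    by apply: xm; rewrite expf_eq0.
  by split; [exists x|rewrite dE xm].
Qed.

Lemma has_side_homothety (R : realType) (P : set (R * R)) (w e : R * R) (l : R) :
  l != 0 -> has_side_parallel_to P e ->
  has_side_parallel_to ((fun x => l *: x + w) @` P) e.
Proof.
move=> l0 [p [q [Ppq pqe]]]; exists (l *: p + w), (l *: q + w).
split; first exact: is_side_homothety.
rewrite opprD addrACA subrr addr0 -scalerBr.
by move: pqe; rewrite /parallel /= /GRing.scale/= -!mulrA => ->.
Qed.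

Lemma rigid_motion_isometry (R : realType) (f : R * R -> R * R) :
  rigid_motion f -> affine_map f /\
  forall p q, dot (f p - f q) (f p - f q) = dot (p - q) (p - q).
Proof.
elim=> [v|c t|g h _ [ag dg] _ [ah dh]].
- split=> [t p q|p q]; last by rewrite /translation opprD addrACA subrr addr0.
  by apply: eq_pair; rewrite /translation /= /GRing.scale/=; ring.
- split=> [s p q|p q].
    by apply: eq_pair; rewrite /rotation /= /GRing.scale/=; ring.
  transitivity ((cos t ^+ 2 + sin t ^+ 2) * dot (p - q) (p - q)).
    by rewrite /rotation /dot /=; ring.
  by rewrite cos2Dsin2 mul1r.
- by split=> [t p q|p q] /=; rewrite ?ah ?ag ?dg ?dh.
Qed.

(** * Equilateral triangles and rhombi *)

(** The triple angle formula at [pi] factors as [(x + 1) * (2 * x - 1) ^+ 2 = 0]. *)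
Lemma cos_pi_third (R : realType) : cos (pi / 3) = 1 / 2 :> R.
Proof.
set x := cos (pi / 3).
have pi0 : 0 < pi :> R := pi_gt0 R.
have x1 : -1 < x.
  rewrite -cospi /x ltr_cos ?in_itv/=; lra.
have c3 : 4 * x ^+ 3 - 3 * x = -1.
  rewrite -cospi (_ : pi = pi / 3 + pi / 3 + pi / 3); last by field.
  rewrite !cosD sinD -/x.
  have : sin (pi / 3) ^+ 2 = 1 - x ^+ 2 :> R by rewrite sin2cos2.
  move: (sin (pi / 3)) => y; rewrite !expr2 => yE.
  by transitivity (x * x * x - 3 * x * (y * y)); [rewrite yE|]; ring.
have /eqP : (x + 1) * (2 * x - 1) ^+ 2 = 0.
  by rewrite (_ : _ * _ = 4 * x ^+ 3 - 3 * x + 1); [rewrite c3; ring|ring].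
rewrite mulf_eq0 expf_eq0/= => /orP[|] /eqP; lra.
Qed.

Lemma cos_rhombus_bounds (R : realType) (alpha : R) :
  pi / 3 < alpha <= 5 * pi / 12 ->
  [/\ 0 < sin alpha, 0 < cos alpha < 1 / 2 & 209 / 3120 <= cos alpha ^+ 2].
Proof.
move=> a_; have pi0 : 0 < pi :> R := pi_gt0 R.
have s0 : 0 < sin alpha by apply: sin_gt0_pi; lra.
have c0 : 0 < cos alpha by apply: cos_gt0_pihalf; lra.
split => //.
  by rewrite c0 -cos_pi_third ltr_cos ?in_itv/=; lra.
have c5 : cos (5 * pi / 12) <= cos alpha by rewrite leNgt ltr_cos ?in_itv/= -?leNgt; lra.
have c50 : 0 < cos (5 * pi / 12 : R) by apply: cos_gt0_pihalf; lra.
apply: (@le_trans _ _ (cos (5 * pi / 12) ^+ 2)); last first.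
  by rewrite lerXn2r ?nnegrE ?(ltW c0) ?(ltW c50).
have s30 : 0 < sin (pi / 3 : R) by apply: sin_gt0_pi; lra.
(* [1351 / 780] is a convergent of [sqrt 3]. *)
have s3 : sin (pi / 3 : R) <= 1351 / 1560.
  have c1 : 0 <= 1351 / 1560 :> R by clear; lra.
  rewrite -(@ler_pXn2r _ 2) ?nnegrE ?(ltW s30) ?c1//.
  by rewrite sin2cos2 cos_pi_third; clear; lra.
(* Doubling the angle gives [(1 - sin (pi / 3)) / 2] for the squared cosine, and [209 / 3120] is
   [(1 - 1351 / 1560) / 2]. *)
have : cos (5 * pi / 12 + 5 * pi / 12 : R) = - sin (pi / 3).
  by rewrite -cosDpihalf; congr cos; field.
rewrite cosD -!expr2 sin2cos2; clear -s3; lra.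
Qed.

(* In the oblique coordinates spanned by the base and the side at 60 degrees, the
   rhombus is [0 <= y <= H, - k * y <= x <= 1 - k * y]. The bound on [k] is
   slightly above [2 - sqrt 3], its value for [alpha = 5 * pi / 12]. *)
Lemma rhombus_parameters (R : realType) (C S : R) :
  0 < S -> 0 < C < 1 / 2 -> C ^+ 2 + S ^+ 2 = 1 -> 209 / 3120 <= C ^+ 2 ->
  let H := (2 * Num.sqrt 3 / 3 * S : R) in
  exists k, [/\ 0 <= k <= 67 / 250, k * H = H / 2 - C, 1 < H <= 2231 / 2000 &
     3 * (2 - k) ^+ 2 < 8 * (1 - k) ^+ 2 * (1 + H)].
Proof.
move=> S0 C0 CS C2 H.
have r0 : 0 < Num.sqrt 3 :> R by rewrite sqrtr_gt0.
have r2 : Num.sqrt 3 ^+ 2 = 3 :> R by rewrite sqr_sqrtr.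
have H0 : 0 < H by rewrite /H !mulr_gt0 ?invr_gt0.
have H2 : 3 * H ^+ 2 = 4 * S ^+ 2 :> R.
  by rewrite /H !exprMn r2; clear; field.
have C24 : C ^+ 2 < (1 / 2) ^+ 2.
  by rewrite ltr_pXn2r ?nnegrE//; clear -C0; lra.
have H1 : 1 < H.
  rewrite -(@ltr_pXn2r _ 2) ?nnegrE ?(ltW H0) ?ler01 //.
  by clear -H2 CS C24; lra.
have H1u : H <= 2231 / 2000.
  have c1 : 0 <= 2231 / 2000 :> R by clear; lra.
  rewrite -(@ler_pXn2r _ 2) ?nnegrE ?(ltW H0) ?c1//.
  by clear -H2 CS C2; lra.
have [k kH] : exists k, k * H = H / 2 - C.
  by exists ((H / 2 - C) / H); rewrite divfK// gt_eqF.
have HC : 2 * C <= H by clear -H1 C0; lra.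
have k0 : 0 <= k by rewrite -(pmulr_lge0 _ H0) kH; clear -HC; lra.
(* The oblique side has length 1: its coordinates in the 60 degree basis are [(- k * H, H)]. *)
have norm1 : H ^+ 2 * (1 - k + k ^+ 2) = 1.
  transitivity (H ^+ 2 - H * (k * H) + (k * H) ^+ 2); first by ring.
  rewrite kH; move: H2 CS; clear; lra.
have ku : k <= 67 / 250.
  rewrite -(ler_pM2r H0) kH.
  have : (116 / 250) * H <= 2 * C.
    have c1 : 0 <= 116 / 250 * H by clear -H0; lra.
    have c2 : 0 <= 2 * C by clear -C0; lra.
    rewrite -(@ler_pXn2r _ 2) ?nnegrE ?c1 ?c2//.
    by rewrite [(_ * H) ^+ 2]exprMn; clear -H2 CS C2; lra.
  by clear; lra.
exists k; split => //; rewrite ?k0 ?H1//.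
(* For small [k] the bound [H > 1] suffices; for larger [k], [norm1] forces [H] up to at least
   [11 / 10]. *)
have [k23|k23] := leP k (23 / 100).
  have : 0 <= (23 / 100 - k) * (1 - k) by rewrite mulr_ge0//; clear -k23; lra.
  have : 16 * (1 - k) ^+ 2 <= 8 * (1 - k) ^+ 2 * (1 + H).
    have : 0 < (1 - k) ^+ 2 * (H - 1).
      by rewrite mulr_gt0 ?exprn_gt0 ?subr_gt0//; clear -k23; lra.
    by clear; lra.
  by clear -k23; lra.
have H11 : 11 / 10 <= H.
  rewrite leNgt; apply/negP => H11.
  have c1 : 0 <= 11 / 10 :> R by clear; lra.
  have : H ^+ 2 < (11 / 10) ^+ 2 by rewrite ltr_pXn2r ?nnegrE ?(ltW H0) ?c1.
  have : 0 <= (k - 23 / 100) * (67 / 250 - k) by rewrite mulr_ge0//; clear -k23 ku; lra.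
  have kk : 0 < 1 - k + k ^+ 2.
    by have := sqr_ge0 k; clear -ku; lra.
  rewrite -(ltr_pM2r kk) norm1; clear -k23 ku; lra.
have : 16 * (1 - k) ^+ 2 + 8 / 10 * (1 - k) ^+ 2 <= 8 * (1 - k) ^+ 2 * (1 + H).
  have : 0 <= (1 - k) ^+ 2 * (H - 11 / 10) by rewrite mulr_ge0 ?sqr_ge0 ?subr_ge0.
  by clear; lra.
have : 0 <= (67 / 250 - k) * (1 - k) by rewrite mulr_ge0//; clear -ku; lra.
by clear -ku k0; lra.
Qed.

Lemma aff_inj (R : realType) (p a b : R * R) :
  det2 a b != 0 -> injective (aff p a b).
Proof.
move=> ab [x y] [x' y']; rewrite /aff -!addrA => /addrI /= E.
have E1 : x * a.1 + y * b.1 = x' * a.1 + y' * b.1 by move/(congr1 fst): E.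
have E2 : x * a.2 + y * b.2 = x' * a.2 + y' * b.2 by move/(congr1 snd): E.
congr pair; apply: (mulIf ab).
  transitivity (b.2 * (x * a.1 + y * b.1) - b.1 * (x * a.2 + y * b.2)).
    by rewrite /det2; ring.
  by rewrite E1 E2 /det2; ring.
transitivity (a.1 * (x * a.2 + y * b.2) - a.2 * (x * a.1 + y * b.1)).
  by rewrite /det2; ring.
by rewrite E1 E2 /det2; ring.
Qed.

(** The image is the preimage under the inverse affine map, written out explicitly. *)
Lemma area_aff_image (R : realType) (p a b : R * R) (X : set (R * R)) :
  det2 a b != 0 -> measurable (X : set (measurableTypeR R * measurableTypeR R)) ->
  area (aff p a b @` X) = (`|det2 a b|%:E * area X)%E.
Proof.
move=> ab mX.
pose D := det2 a b.
pose a' : R * R := (b.2 / D, - a.2 / D).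
pose b' : R * R := (- b.1 / D, a.1 / D).
pose p' : R * R := - (p.1 *: a' + p.2 *: b').
have DE : a.1 * b.2 - a.2 * b.1 != 0 by [].
have dE : det2 a' b' = D^-1.
  by rewrite /det2 /= /D /det2; field.
have K q : aff p' a' b' (aff p a b q) = q.
  apply: eq_pair; rewrite /aff /p' /a' /b' /D /det2 /= /GRing.scale/=;
    by field.
have K' q : aff p a b (aff p' a' b' q) = q.
  by apply: (@aff_inj _ p' a' b'); rewrite ?K// dE invr_eq0.
have -> : aff p a b @` X = aff p' a' b' @^-1` X.
  apply/seteqP; split => [_ [q Xq <-]|q Xq]; first by rewrite /= K.
  by exists (aff p' a' b' q).
rewrite area_aff_preimage// ?dE ?invr_eq0//.
by rewrite normfV invrK.
Qed.

Definition rot90 (R : realType) (u : R * R) : R * R := (- u.2, u.1).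

(** This is [u] turned by 60 degrees, counterclockwise for [sg = 1] and clockwise for [sg = -1]. *)
Definition side60 (R : realType) (sg : R) (u : R * R) : R * R :=
  (1 / 2) *: u + (sg * (Num.sqrt 3 / 2)) *: rot90 u.

Lemma sqrt3_sqr (R : realType) : Num.sqrt 3 ^+ 2 = 3 :> R.
Proof. by rewrite sqr_sqrtr. Qed.

Lemma det2_side60 (R : realType) (sg : R) (u : R * R) :
  dot u u = 1 -> det2 u (side60 sg u) = sg * (Num.sqrt 3 / 2).
Proof.
move=> u1; transitivity (sg * (Num.sqrt 3 / 2) * dot u u); last by rewrite u1 mulr1.
by rewrite /det2 /side60 /rot90 /dot /= /GRing.scale/=; ring.
Qed.

Lemma norm_det2_side60 (R : realType) (sg : R) (u : R * R) :
  dot u u = 1 -> sg ^+ 2 = 1 -> `|det2 u (side60 sg u)| = Num.sqrt 3 / 2.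
Proof.
move=> u1 sg1; rewrite det2_side60// normrM [X in _ * X]ger0_norm ?divr_ge0 ?sqrtr_ge0//.
have /eqP : `|sg| ^+ 2 = 1 ^+ 2 by rewrite -normrX sg1 normr1 expr1n.
by rewrite eqrXn2// => /eqP ->; rewrite mul1r.
Qed.

Lemma enorm_sqr (R : realType) (u : R * R) : enorm u ^+ 2 = dot u u.
Proof. by rewrite sqr_sqrtr ?dot_ge0. Qed.

Lemma enorm_eq0 (R : realType) (u : R * R) : (enorm u == 0) = (u == 0).
Proof. by rewrite -dot_eq0 -enorm_sqr sqrf_eq0. Qed.

Lemma frame_decomp (R : realType) (u w : R * R) :
  dot u u = 1 -> w = dot w u *: u + dot w (rot90 u) *: rot90 u.
Proof.
move=> u1; apply: eq_pair; rewrite /rot90 /dot /= /GRing.scale/=.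
  transitivity (w.1 * dot u u); first by rewrite u1 mulr1.
  by rewrite /dot; ring.
transitivity (w.2 * dot u u); first by rewrite u1 mulr1.
by rewrite /dot; ring.
Qed.

Lemma equilateral_base (R : realType) (sg : R) (u a b c : R * R) :
  dot u u = 1 -> sg ^+ 2 = 1 -> a != b -> parallel (b - a) u ->
  enorm (c - a) = enorm (b - a) -> enorm (c - b) = enorm (b - a) ->
  exists w m, [/\ m != 0, `|m| = enorm (b - a) &
    convex_hull [set a; b; c] = aff w (m *: u) (m *: side60 sg u) @` simplex2].
Proof.
move=> u1 sg1 ab bu cab cbb.
pose m := dot (b - a) u.
have bE : b - a = m *: u.
  rewrite {1}(frame_decomp (b - a) u1) -/m (_ : dot _ (rot90 u) = 0) ?scale0r ?addr0//.
  by move: bu; rewrite /parallel /rot90 /dot /= mulrN => ->; rewrite addNr.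
have m2 : enorm (b - a) ^+ 2 = m ^+ 2.
  transitivity (m ^+ 2 * dot u u); last by rewrite u1 mulr1.
  by rewrite enorm_sqr bE /dot /= /GRing.scale/=; ring.
have m0 : m != 0.
  apply: contra ab => /eqP m0; move: bE; rewrite m0 scale0r => /eqP.
  by rewrite subr_eq0 eq_sym.
have nm : `|m| = enorm (b - a).
  apply/eqP; rewrite -(@eqrXn2 _ 2)// ?sqrtr_ge0//.
  by rewrite m2 -normrX ger0_norm ?sqr_ge0.
pose w := c - a.
have w2 : dot w w = m ^+ 2 by rewrite -enorm_sqr /w cab m2.
have wm2 : dot (w - m *: u) (w - m *: u) = m ^+ 2.
  by rewrite -m2 -cbb enorm_sqr /w -bE opprB addrA subrK.
pose s := dot w (rot90 u).
have wE : w = dot w u *: u + s *: rot90 u by exact: frame_decomp.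
have wu : dot w u = m / 2.
  apply: (mulfI m0).
  have : dot (w - m *: u) (w - m *: u) = dot w w - 2 * (m * dot w u) + m ^+ 2 * dot u u.
    by rewrite /dot /= /GRing.scale/=; ring.
  by rewrite wm2 w2 u1; clear; lra.
have s2 : s ^+ 2 = 3 / 4 * m ^+ 2.
  have : dot w w * dot u u = dot w u ^+ 2 + s ^+ 2.
    by rewrite /s /rot90 /dot /=; ring.
  by rewrite w2 u1 wu; clear; lra.
have /eqP : (s - m * (sg * (Num.sqrt 3 / 2))) * (s + m * (sg * (Num.sqrt 3 / 2))) = 0.
  transitivity (s ^+ 2 - m ^+ 2 * sg ^+ 2 * Num.sqrt 3 ^+ 2 / 4); first by field.
  by rewrite s2 sg1 sqrt3_sqr; field.
rewrite mulf_eq0 => /orP[|] /eqP sE.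
  exists a, m; split => //; rewrite convex_hull3 bE -/w.
  congr (aff _ _ _ @` _); rewrite wE wu /side60.
  have -> : s = m * (sg * (Num.sqrt 3 / 2)) by apply/eqP; rewrite -subr_eq0 sE.
  by rewrite scalerDr !scalerA mul1r.
exists b, (- m); split; rewrite ?oppr_eq0 ?normrN//.
have -> : [set a; b; c] = [set b; a; c] by rewrite [X in X `|` _]setUC.
rewrite convex_hull3 -[a - b]opprB bE scaleNr.
congr (aff _ _ _ @` _).
have -> : c - b = w - m *: u by rewrite /w -bE opprB addrA subrK.
rewrite wE wu /side60.
have -> : s = - m * (sg * (Num.sqrt 3 / 2)).
  by apply/eqP; rewrite -subr_eq0 mulNr opprK sE.
by apply: eq_pair; rewrite /= /GRing.scale/=; field.
Qed.

Lemma equilateral_frame (R : realType) (sg : R) (u e a b c : R * R) :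
  dot u u = 1 -> sg ^+ 2 = 1 -> a != b ->
  enorm (b - a) = enorm (c - b) -> enorm (c - b) = enorm (a - c) ->
  e != 0 -> parallel e u -> has_side_parallel_to (convex_hull [set a; b; c]) e ->
  exists w m, [/\ m != 0, `|m| = enorm (b - a) &
    convex_hull [set a; b; c] = aff w (m *: u) (m *: side60 sg u) @` simplex2].
Proof.
move=> u1 sg1 ab abc bca e0 eu [p [q [Tpq pqe]]].
have enormN (x y : R * R) : enorm (x - y) = enorm (y - x).
  by rewrite /enorm -opprB /dot /= !mulrNN.
have pqu : parallel (q - p) u := parallel_trans e0 pqe eu.
have pq0 : q - p != 0 by case: Tpq => [pq _]; rewrite subr_eq0 eq_sym.
have toU x : parallel (q - p) x -> parallel x u.
  by move=> pqx; exact: (parallel_trans pq0 (parallel_sym pqx)).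
pose n2 := enorm (b - a) ^+ 2.
have n0 : 0 < n2.
  by rewrite exprn_even_gt0//= enorm_eq0 subr_eq0 eq_sym.
have det0 : det2 (b - a) (c - a) != 0.
  have A2 : dot (b - a) (b - a) = n2 by rewrite -enorm_sqr.
  have B2 : dot (c - a) (c - a) = n2 by rewrite -enorm_sqr enormN -bca -abc.
  have C2 : dot (c - b) (c - b) = n2 by rewrite -enorm_sqr -abc.
  have AB : dot (b - a) (c - a) = n2 / 2.
    have : dot (c - b) (c - b) = dot (b - a) (b - a) + dot (c - a) (c - a)
        - 2 * dot (b - a) (c - a) by rewrite /dot /=; ring.
    by rewrite A2 B2 C2; clear; lra.
  have : det2 (b - a) (c - a) ^+ 2 = dot (b - a) (b - a) * dot (c - a) (c - a)
      - dot (b - a) (c - a) ^+ 2 by rewrite /det2 /dot; ring.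
  rewrite A2 B2 AB => dE; rewrite -sqrf_eq0 dE.
  have -> : n2 * n2 - (n2 / 2) ^+ 2 = 3 / 4 * n2 ^+ 2 by field.
  have : 0 < n2 ^+ 2 by rewrite exprn_gt0.
  by move=> n4; rewrite gt_eqF//; clear -n4; lra.
have := Tpq; rewrite convex_hull3 => /(triangle_side det0)[] /toU xu; rewrite -convex_hull3.
- by apply: equilateral_base => //; rewrite ?abc ?bca// enormN.
- have -> : [set a; b; c] = [set a; c; b] by rewrite -!setUA [[set b] `|` _]setUC.
  have -> : enorm (b - a) = enorm (c - a) by rewrite abc bca enormN.
  apply: equilateral_base => //; rewrite ?(enormN b c) ?abc ?bca ?(enormN a c)//.
  by apply: contraTneq n0 => ac; rewrite /n2 abc bca ac subrr /enorm /dot /= mulr0 addr0 sqrtr0 expr0n ltxx.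
have -> : [set a; b; c] = [set b; c; a] by rewrite -!setUA setUC -setUA.
rewrite abc; apply: equilateral_base => //.
- by apply: contraTneq n0 => bc; rewrite /n2 abc bc subrr /enorm /dot /= mulr0 addr0 sqrtr0 expr0n ltxx.
- by move: xu; rewrite opprB addrA subrK.
- by rewrite enormN abc.
Qed.

Lemma area_equilateral (R : realType) (sg m : R) (u w : R * R) :
  dot u u = 1 -> sg ^+ 2 = 1 -> m != 0 ->
  area (aff w (m *: u) (m *: side60 sg u) @` simplex2) =
    (Num.sqrt 3 / 4 * m ^+ 2)%:E.
Proof.
move=> u1 sg1 m0.
have dE : det2 (m *: u) (m *: side60 sg u) = m ^+ 2 * det2 u (side60 sg u).
  by rewrite /det2 /= /GRing.scale/=; ring.
have d0 : 0 < `|det2 u (side60 sg u)|.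
  by rewrite norm_det2_side60// divr_gt0 ?sqrtr_gt0.
rewrite area_aff_image; first last.
- exact: measurable_simplex2.
- by rewrite dE mulf_neq0 ?expf_eq0// -normr_gt0.
rewrite area_simplex2 -EFinM dE normrM norm_det2_side60//.
by rewrite ger0_norm ?sqr_ge0//; congr EFin; field.
Qed.

Lemma rhombus_frame (R : realType) (alpha : R) (u v : R * R) :
  0 < sin alpha -> enorm u = 1 -> enorm v = 1 -> angle u v = alpha ->
  exists sg, [/\ sg ^+ 2 = 1, dot u u = 1, dot v v = 1, `|det2 u v| = sin alpha &
    v = (2 * Num.sqrt 3 / 3 * sin alpha) *: side60 sg u
        - (2 * Num.sqrt 3 / 3 * sin alpha / 2 - cos alpha) *: u].
Proof.
move=> s0 u1 v1; rewrite /angle u1 v1 mulr1 divr1 => uv.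
have uu : dot u u = 1 by rewrite -enorm_sqr u1 expr1n.
have vv : dot v v = 1 by rewrite -enorm_sqr v1 expr1n.
have uv2 : dot u v ^+ 2 + det2 u v ^+ 2 = 1.
  transitivity (dot u u * dot v v); last by rewrite uu vv mulr1.
  by rewrite /dot /det2; ring.
have uv1 : -1 <= dot u v <= 1.
  rewrite -ler_norml -(@ler_pXn2r _ 2) ?nnegrE// -normrX ger0_norm ?sqr_ge0//.
  by rewrite expr1n -uv2 lerDl sqr_ge0.
have c : cos alpha = dot u v by rewrite -uv acosK// in_itv.
have s2 : det2 u v ^+ 2 = sin alpha ^+ 2.
  by rewrite sin2cos2 c -uv2 addrC addKr.
have sn : sin alpha != 0 by rewrite gt_eqF.
exists (det2 u v / sin alpha); split => //.
- by rewrite exprMn exprVn s2 divff// sqrf_eq0.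
- apply/eqP; rewrite -(@eqrXn2 _ 2) ?(ltW s0)//.
  by rewrite -normrX ger0_norm ?sqr_ge0// s2.
have r3 : Num.sqrt 3 * Num.sqrt 3 = 3 :> R by rewrite -expr2 sqrt3_sqr.
rewrite {1}(frame_decomp v uu) c /side60.
have -> : dot v u = dot u v by rewrite /dot; ring.
have -> : dot v (rot90 u) = det2 u v by rewrite /dot /rot90 /det2 /=; ring.
have e1 : 2 * Num.sqrt 3 / 3 * sin alpha * (det2 u v / sin alpha * (Num.sqrt 3 / 2)) = det2 u v.
  transitivity (Num.sqrt 3 * Num.sqrt 3 / 3 * det2 u v); first by field.
  by rewrite r3; field.
move: (det2 u v) e1 => D e1; rewrite scalerDr !scalerA e1.
rewrite addrAC -scalerBl; by congr (_ *: _ + _); field.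
Qed.

Lemma area_rhombus (R : realType) (p u v : R * R) :
  det2 u v != 0 -> area (aff p u v @` square2) = `|det2 u v|%:E.
Proof.
move=> uv; rewrite area_aff_image//; last exact: measurable_square2.
by rewrite area_square2 mule1.
Qed.

(** Three vertices of the rhombus, one for each side of the triangle, suffice; the sign of [m]
    decides which three. *)
Lemma triangle_around_rhombus (R : realType) (H k m : R) (p w u d v : R * R) :
  det2 u d != 0 -> v = H *: d - (k * H) *: u ->
  aff p u v @` square2 `<=` aff w (m *: u) (m *: d) @` simplex2 -> 1 + H <= `|m|.
Proof.
move=> ud vE PT.
have affm q : aff w (m *: u) (m *: d) q = aff w u d (m * q.1, m * q.2).
  by rewrite /aff /= !scalerA ![m * _]mulrC.
have vertex x y : 0 <= x <= 1 -> 0 <= y <= 1 -> exists2 q,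
    simplex2 q & aff p u v (x, y) = aff w u d (m * q.1, m * q.2).
  move=> x01 y01.
  have [|q Sq qE] := PT (aff p u v (x, y)).
    by exists (x, y) => //; split; rewrite /= in_itv.
  by exists q => //; rewrite -affm.
have i0 : 0 <= (0 : R) <= 1 by rewrite lexx ler01.
have i1 : 0 <= (1 : R) <= 1 by rewrite lexx ler01.
have [q0 [x0_ y0_ xy0] E0] := vertex _ _ i0 i0.
have rel x y q : aff p u v (x, y) = aff w u d (m * q.1, m * q.2) ->
    m * q.1 = m * q0.1 + x - y * (k * H) /\ m * q.2 = m * q0.2 + y * H.
  move=> E; suff /(aff_inj ud)[-> ->] : aff w u d (m * q.1, m * q.2) =
    aff w u d (m * q0.1 + x - y * (k * H), m * q0.2 + y * H) by [].
  rewrite -E; have : aff p u v (x, y) = aff p u v (0, 0) + x *: u + y *: v.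
    by rewrite /aff /= !scale0r !addr0.
  by rewrite E0 vE => ->; apply: eq_pair; rewrite /aff /= /GRing.scale/=; ring.
have [q1 [x1_ y1_ xy1] /rel[E1 E1']] := vertex _ _ i1 i0.
have [q2 [x2_ y2_ xy2] /rel[E2 E2']] := vertex _ _ i0 i1.
have [q3 [x3_ y3_ xy3] /rel[E3 E3']] := vertex _ _ i1 i1.
have [m0|m0] := leP 0 m.
  rewrite ger0_norm//.
  have h1 : 0 <= m * q2.1 by rewrite mulr_ge0.
  have h2 : 0 <= m * q0.2 by rewrite mulr_ge0.
  have h3 : 0 <= m * (1 - (q3.1 + q3.2)) by rewrite mulr_ge0// subr_ge0.
  by clear -h1 h2 h3 E2 E3 E3'; lra.
rewrite ltr0_norm//.
have h1 : m * q1.1 <= 0 by rewrite nmulr_rle0.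
have h2 : m * q2.2 <= 0 by rewrite nmulr_rle0.
have h3 : m * (1 - (q0.1 + q0.2)) <= 0 by rewrite nmulr_rle0// subr_ge0.
by clear -h1 h2 h3 E1 E2'; lra.
Qed.

(** * Covering the rhombus, and optimality of the ratio *)

Lemma finite_subfamily (R : realType) (I : set nat) (T : nat -> set (R * R))
    (s : nat -> R) (c A e : R) :
  0 < c -> 0 < e -> (forall n, I n -> area (T n) = (c * s n ^+ 2)%:E) ->
  ((c * A)%:E <= total_area I T)%E ->
  exists js : seq nat, [/\ uniq js, forall j, j \in js -> I j &
    A - e <= \sum_(j <- js) s j ^+ 2].
Proof.
move=> c0 e0 aT cA.
have : ((c * (A - e))%:E < total_area I T)%E.
  apply: lt_le_trans cA; rewrite lte_fin ltr_pM2l//.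
  by rewrite ltrBlDr ltrDl.
move=> /ereal_sup_gt[_ [X [finX XI] <-]]; rewrite fsbig_finite//= => hX.
set js := finmap.enum_fset (fset_set X) in hX *.
have jsX j : j \in js -> X j.
  by move=> jjs; apply: set_mem; rewrite -(in_fset_set finX).
exists js; split; [exact: finmap.fset_uniq|by move=> j /jsX /XI|].
have XE : (\sum_(n <- js) area (T n))%E = (c * \sum_(j <- js) s j ^+ 2)%:E.
  rewrite mulr_sumr -sumEFin !big_seq; apply: eq_bigr => j.
  by move=> /jsX /XI /aT.
by move: hX; rewrite XE lte_fin ltr_pM2l// => /ltW.
Qed.

Lemma rigid_motion_pm (R : realType) (e : R) (c : R * R) :
  e = 1 \/ e = -1 -> rigid_motion (fun x => e *: x + c).
Proof.
case=> ->.
  have -> : (fun x => 1 *: x + c) = translation c.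
    by apply/funext => x; rewrite scale1r.
  exact: rigid_translation.
have -> : (fun x => -1 *: x + c) = translation c \o rotation 0 pi.
  apply/funext => x; rewrite /translation /= /rotation cospi sinpi.
  by apply: eq_pair; rewrite /= /GRing.scale/=; ring.
by apply: rigid_comp; [exact: rigid_translation|exact: rigid_rotation].
Qed.

Lemma aff_tri (R : realType) (up : bool) (s : R) (p u d z q : R * R) :
  0 < s -> tri up z s q ->
  let m := if up then s else - s in
  (aff (aff p u d z) (m *: u) (m *: d) @` simplex2) (aff p u d q).
Proof.
move=> s0 Tq m.
have m0 : m != 0 by rewrite /m; case: up {m Tq}; rewrite ?oppr_eq0 gt_eqF.
exists ((q.1 - z.1) / m, (q.2 - z.2) / m).
  rewrite /m; case: up Tq {m m0} => -[/= h1 h2 h3]; split => /=.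
  - by rewrite divr_ge0 ?subr_ge0 ?(ltW s0).
  - by rewrite divr_ge0 ?subr_ge0 ?(ltW s0).
  - by rewrite -mulrDl ler_pdivrMr// mul1r; clear -h3; lra.
  - by rewrite invrN mulrN -mulNr opprB divr_ge0 ?subr_ge0 ?(ltW s0).
  - by rewrite invrN mulrN -mulNr opprB divr_ge0 ?subr_ge0 ?(ltW s0).
  - rewrite invrN !mulrN -!mulNr !opprB -mulrDl ler_pdivrMr// mul1r.
    by clear -h3; lra.
by apply: eq_pair; rewrite /aff /= /GRing.scale/=; field.
Qed.

Lemma rhombus_parallel_cover (R : realType) (k H sg m0 : R)
    (p u v w0 : R * R) (D : set (R * R)) (I : set nat) (T : nat -> set (R * R)) :
  0 <= k <= 67 / 250 -> 1 < H <= 2231 / 2000 ->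
  3 * (2 - k) ^+ 2 < 8 * (1 - k) ^+ 2 * (1 + H) ->
  dot u u = 1 -> sg ^+ 2 = 1 -> v = H *: side60 sg u - (k * H) *: u ->
  m0 != 0 -> D = aff w0 (m0 *: u) (m0 *: side60 sg u) @` simplex2 ->
  (exists p' q', is_side (aff p u v @` square2) p' q' /\
     has_side_parallel_to D (q' - p')) ->
  homothetic_collection D I T ->
  ((Num.sqrt 3 / 4 * (1 + H) ^+ 2)%:E <= total_area I T)%E ->
  permits_parallel_covering I T (aff p u v @` square2).
Proof.
move=> k1 H1 kH u1 sg1 vE m00 DE [p' [q' [side Dside]]] hT hA.
have [kv kvP] : {kv : nat -> R * (R * R) & forall n, I n ->
    (kv n).1 != 0 /\ T n = [set (kv n).1 *: x + (kv n).2 | x in D]}.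
  apply: (@choice _ _ (fun n kv => I n ->
    kv.1 != 0 /\ T n = [set kv.1 *: x + kv.2 | x in D])) => n.
  have [In|nIn] := pselect (I n); last by exists (0, 0).
  by have [l [y [l0 TE]]] := hT n In; exists (l, y).
set d := side60 sg u in vE DE *.
pose mu n := (kv n).1 * m0.
pose w n := (kv n).1 *: w0 + (kv n).2.
have mu0 n : I n -> mu n != 0 by move=> /kvP[l0 _]; rewrite mulf_neq0.
have TE n : I n -> T n = aff (w n) (mu n *: u) (mu n *: d) @` simplex2.
  move=> /kvP[_ ->]; rewrite DE image_comp; congr (_ @` _).
  apply/funext => q; apply: eq_pair;
    by rewrite /= /aff /w /mu /= /GRing.scale/=; ring.
have aT n : I n -> area (T n) = (Num.sqrt 3 / 4 * `|mu n| ^+ 2)%:E.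
  move=> In; rewrite TE// area_equilateral//; last exact: mu0.
  by rewrite -normrX ger0_norm ?sqr_ge0.
have c0 : 0 < Num.sqrt 3 / 4 :> R by rewrite divr_gt0 ?sqrtr_gt0.
have s0 n : I n -> 0 < `|mu n| by move=> /mu0; rewrite normr_gt0.
have [pl plP] := affine_cover k1 H1 kH s0 (fun e e0 => finite_subfamily c0 e0 aT hA).
pose up n := (pl n).1.
pose z n := aff p u d (pl n).2.
pose M n := if up n then `|mu n| else - `|mu n|.
(* [mu n] is the signed side of the given triangle and [M n] the one its place requires; they agree
   up to sign, so a translation or a half-turn is enough, and directions of sides are kept. *)
pose e n := M n / mu n.
pose c n := z n - e n *: w n.
have e1 n : I n -> e n = 1 \/ e n = -1.
  move=> /mu0 m0n; have : e n ^+ 2 = 1.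
    rewrite /e exprMn exprVn (_ : M n ^+ 2 = mu n ^+ 2) ?divff ?expf_eq0//.
    by rewrite /M; case: (up n); rewrite ?sqrrN -normrX ger0_norm ?sqr_ge0.
  by move=> /eqP; rewrite sqrf_eq1 => /orP[] /eqP; [left|right].
exists (fun n x => e n *: x + c n); split.
- by move=> n In; apply: rigid_motion_pm; exact: e1.
- move=> _ [[x y] [/= x01 y01] <-]; move: x01 y01; rewrite !in_itv/= => x01 y01.
  pose q := (x - y * (k * H), y * H).
  have qE : aff p u v (x, y) = aff p u d q.
    by rewrite vE; apply: eq_pair; rewrite /aff /= /GRing.scale/=; ring.
  have Pq : parallelogram k H q.
    have H0 : 0 <= H by clear -H1; lra.
    move: y01 => /andP[y0 y1]; split; rewrite /q /=.
      by rewrite mulr_ge0//= -subr_ge0 -[X in X - _]mul1r -mulrBl mulr_ge0// subr_ge0.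
    by clear -x01; lra.
  have [n In Tn] := plP q Pq; exists n => //.
  rewrite TE//.
  have [r Sr rE] := aff_tri p u d (s0 n In) Tn.
  rewrite qE -rE; exists (aff (w n) (mu n *: u) (mu n *: d) r); first by exists r.
  have eM : e n * mu n = M n by rewrite /e divfK// mu0.
  rewrite -/(up n) -/(M n) -/(z n) -eM /c.
  by apply: eq_pair; rewrite /aff /= /GRing.scale/=; ring.
exists p', q'; split => // n In.
have [l0 ->] := kvP n In.
rewrite image_comp (_ : _ \o _ = fun x => (e n * (kv n).1) *: x + (e n *: (kv n).2 + c n)).
  apply: has_side_homothety => //; rewrite mulf_neq0//.
  by case: (e1 n In) => ->; rewrite ?oppr_eq0 oner_eq0.
by apply/funext => x; apply: eq_pair; rewrite /= /GRing.scale/=; ring.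
Qed.

Lemma rhombus_lower_bound (R : realType) (alpha : R) (p u v e a b c : R * R) :
  pi / 3 < alpha <= 5 * pi / 12 ->
  enorm u = 1 -> enorm v = 1 -> angle u v = alpha ->
  a != b -> enorm (b - a) = enorm (c - b) -> enorm (c - b) = enorm (a - c) ->
  e != 0 -> parallel e u -> has_side_parallel_to (convex_hull [set a; b; c]) e ->
  aff p u v @` square2 `<=` convex_hull [set a; b; c] ->
  1 + 2 * Num.sqrt 3 / 3 * sin alpha <= enorm (b - a).
Proof.
move=> halpha u1 v1 uv ab abc bca e0 eu side sub.
have [s0 c0 c2] := cos_rhombus_bounds halpha.
have [sg [sg1 uu _ _ vE]] := rhombus_frame s0 u1 v1 uv.
have cs : cos alpha ^+ 2 + sin alpha ^+ 2 = 1 by exact: cos2Dsin2.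
have [k [_ kH _ _]] := rhombus_parameters s0 c0 cs c2.
have [w [m [m0 <- E]]] := equilateral_frame uu sg1 ab abc bca e0 eu side.
apply: (@triangle_around_rhombus R _ k m p w u (side60 sg u) v).
- by rewrite -normr_gt0 norm_det2_side60// divr_gt0 ?sqrtr_gt0.
- by rewrite kH -vE.
- by rewrite -E.
Qed.

Lemma rhombus_cover_ratio (R : realType) (alpha : R) (D : set (R * R))
    (p u v e p' q' : R * R) :
  pi / 3 < alpha <= 5 * pi / 12 ->
  enorm u = 1 -> enorm v = 1 -> angle u v = alpha ->
  equilateral_triangle D -> is_side (aff p u v @` square2) p' q' ->
  has_side_parallel_to D (q' - p') -> parallel (q' - p') u ->
  (forall (I : set nat) (T : nat -> set (R * R)),
     homothetic_collection D I T ->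
     ((Num.sqrt 3 / 4 * (1 + 2 * Num.sqrt 3 / 3 * sin alpha) ^+ 2)%:E
        <= total_area I T)%E ->
     permits_parallel_covering I T (aff p u v @` square2)) /\
  is_rho (aff p u v @` square2) D
    (Num.sqrt 3 * (Num.sqrt 3 + 2 * sin alpha) ^+ 2 / (12 * sin alpha)).
Proof.
move=> halpha u1 v1 uv [a [b [c [ab abc bca DE]]]] side Dside pqu.
have [s0 c0 c2] := cos_rhombus_bounds halpha.
have [sg [sg1 uu vv dE vE]] := rhombus_frame s0 u1 v1 uv.
have cs : cos alpha ^+ 2 + sin alpha ^+ 2 = 1 by exact: cos2Dsin2.
have [k [k1 kH H1 kH2]] := rhombus_parameters s0 c0 cs c2.
have pq0 : q' - p' != 0 by case: side => [pq _]; rewrite subr_eq0 eq_sym.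
have [w0 [m0 [m00 m0E DE']]] : exists w m, [/\ m != 0, `|m| = enorm (b - a) &
    D = aff w (m *: u) (m *: side60 sg u) @` simplex2].
  by rewrite DE; apply: (@equilateral_frame _ _ _ (q' - p')) => //; rewrite -DE.
have cover I T : homothetic_collection D I T ->
    ((Num.sqrt 3 / 4 * (1 + 2 * Num.sqrt 3 / 3 * sin alpha) ^+ 2)%:E
        <= total_area I T)%E ->
    permits_parallel_covering I T (aff p u v @` square2).
  apply: (@rhombus_parallel_cover R k _ sg m0 p u v w0 D) => //.
  - by rewrite kH -vE.
  - by exists p', q'.
have uv0 : det2 u v != 0 by rewrite -normr_gt0 dE.
have areaR : area (aff p u v @` square2) = (sin alpha)%:E.
  by rewrite area_rhombus// dE.
have r0 : 0 < Num.sqrt 3 :> R by rewrite sqrtr_gt0.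
have rhoE : Num.sqrt 3 * (Num.sqrt 3 + 2 * sin alpha) ^+ 2 / (12 * sin alpha)
    * sin alpha = Num.sqrt 3 / 4 * (1 + 2 * Num.sqrt 3 / 3 * sin alpha) ^+ 2.
  have := sqrt3_sqr R; move: (Num.sqrt 3) => r r2.
  transitivity (r / 12 * (r ^+ 2 + 4 * r * sin alpha + 4 * sin alpha ^+ 2)).
    by field; rewrite gt_eqF.
  transitivity (r / 4 * (1 + 4 * r / 3 * sin alpha + 4 * r ^+ 2 / 9 * sin alpha ^+ 2)).
    by rewrite r2; field.
  by field.
split => //; split.
  split; first by rewrite divr_gt0 ?mulr_gt0 ?exprn_gt0 ?addr_gt0 ?mulr_gt0.
  by move=> I T hT; rewrite areaR -EFinM rhoE; exact: cover.
move=> r [rgt0 hr]; rewrite leNgt; apply/negP => rlt.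
(* A single triangle of side [m] has area exactly [r] times that of the rhombus. If [r] were
   admissible, a rigid copy of it would contain the rhombus, although [m] is too small. *)
pose m := Num.sqrt (4 * r * sin alpha / Num.sqrt 3).
have m2 : Num.sqrt 3 / 4 * m ^+ 2 = r * sin alpha.
  by rewrite sqr_sqrtr ?divr_ge0 ?mulr_ge0 ?(ltW r0) ?(ltW s0) ?(ltW rgt0)//; field; rewrite gt_eqF.
have mgt0 : 0 < m by rewrite sqrtr_gt0 divr_gt0 ?mulr_gt0.
pose l := m / m0.
have lgt0 : l != 0 by rewrite mulf_neq0 ?invr_eq0// gt_eqF.
pose f (x : R * R) := l *: x + 0.
have af : affine_map f.
  by move=> t x y; apply: eq_pair; rewrite /f /= /GRing.scale/=; ring.
have fD : f @` D = aff (l *: w0) (m *: u) (m *: side60 sg u) @` simplex2.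
  rewrite DE' image_comp; congr (_ @` _); apply/funext => q.
  by apply: eq_pair; rewrite /f /aff /l /= /GRing.scale/=; field.
have [||sg' [rig sub [p1 [q1 [side1 Tside]]]]] := hr [set 0%N] (fun=> f @` D).
- by move=> _ _; exists l, 0.
- rewrite areaR /total_area esum_set1 fD area_equilateral ?gt_eqF// ?lee_fin.
    by rewrite m2.
  by rewrite mulr_ge0 ?sqr_ge0 ?divr_ge0 ?ltW.
have [ag dg] := rigid_motion_isometry (rig 0%N erefl).
pose g := sg' 0%N.
have gD : g @` (f @` D) = convex_hull [set g (f a); g (f b); g (f c)].
  rewrite DE -convex_hull_image// -convex_hull_image//.
  by rewrite !image_setU !image_set1.
have gN x y : enorm (g (f x) - g (f y)) = `|l| * enorm (x - y).
  apply/eqP; rewrite -(@eqrXn2 _ 2) ?mulr_ge0 ?sqrtr_ge0 ?normr_ge0//.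
  rewrite exprMn -normrX (ger0_norm (sqr_ge0 l)) !enorm_sqr dg.
  by apply/eqP; rewrite /f /dot /= /GRing.scale/=; ring.
have gab : g (f a) != g (f b).
  rewrite -subr_eq0 -enorm_eq0 gN mulf_neq0 ?normr_eq0//.
  by rewrite enorm_eq0 subr_eq0.
have gabc : enorm (g (f b) - g (f a)) = enorm (g (f c) - g (f b)).
  by rewrite !gN abc.
have gbca : enorm (g (f c) - g (f b)) = enorm (g (f a) - g (f c)).
  by rewrite !gN bca.
have pq1 : q1 - p1 != 0 by case: side1 => [pq _]; rewrite subr_eq0 eq_sym.
have gside := Tside 0%N erefl; rewrite -/g gD in gside.
have gsub : aff p u v @` square2 `<=` convex_hull [set g (f a); g (f b); g (f c)].
  by move=> x /sub[n -> Tx]; rewrite -gD.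
have : 1 + 2 * Num.sqrt 3 / 3 * sin alpha <= enorm (g (f b) - g (f a)).
  (* The base of this covering may be a side of either direction; exchanging [u] and [v] reduces the
     second case to the first. *)
  have [pqu1|pqv1] := parallelogram_side uv0 side1.
    exact: (rhombus_lower_bound halpha u1 v1 uv gab gabc gbca pq1 pqu1 gside gsub).
  have vu : angle v u = alpha.
    by rewrite -uv /angle [enorm v * _]mulrC /dot [v.1 * _]mulrC [v.2 * _]mulrC.
  apply: (rhombus_lower_bound halpha v1 u1 vu gab gabc gbca pq1 pqv1 gside).
  move=> _ [[x y] [/= x1 y1] <-]; apply: gsub; exists (y, x) => //.
  by rewrite /aff /= addrAC.
rewrite gN -m0E -normrM /l divfK// gtr0_norm// => Lm.
move: rlt; rewrite -(ltr_pM2r s0) rhoE -m2 ltr_pM2l ?divr_gt0//.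
rewrite ltNge => /negP; apply.
rewrite lerXn2r ?nnegrE// ?(ltW mgt0)//.
by rewrite addr_ge0 ?mulr_ge0 ?invr_ge0 ?(ltW r0) ?(ltW s0).
Qed.

Theorem theorem3p2 (R : realType) (alpha : R) (Ra D : set (R * R))
    (halpha : pi / 3 < alpha <= 5 * pi / 12)
    (hRa : rhombus 1 alpha Ra)
    (hD : equilateral_triangle D)
    (hbase : exists p q : R * R,
       is_side Ra p q /\ has_side_parallel_to D (q - p)) :
  (forall (I : set nat) (T : nat -> set (R * R)),
     homothetic_collection D I T ->
     ((Num.sqrt 3 / 4 * (1 + 2 * Num.sqrt 3 / 3 * sin alpha) ^+ 2)%:E
        <= total_area I T)%E ->
     permits_parallel_covering I T Ra) /\
  is_rho Ra D
    (Num.sqrt 3 * (Num.sqrt 3 + 2 * sin alpha) ^+ 2 / (12 * sin alpha)).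
Proof.
case: hRa => p [u [v [u1 v1 uv RaE]]].
have [s0 _ _] := cos_rhombus_bounds halpha.
have [_ [_ _ _ dE _]] := rhombus_frame s0 u1 v1 uv.
have uv0 : det2 u v != 0 by rewrite -normr_gt0 dE.
case: hbase => p' [q' [side Dside]].
have RaE1 : Ra = aff p u v @` square2 by rewrite RaE convex_hull4.
have [pqu|pqv] : parallel (q' - p') u \/ parallel (q' - p') v.
  by move: side; rewrite RaE1; exact: parallelogram_side.
- by rewrite RaE1 in side *; apply: rhombus_cover_ratio side Dside pqu.
have RaE2 : Ra = aff p v u @` square2.
  rewrite RaE1; apply/seteqP; split => _ [[x y] [/= x1 y1] <-];
    by exists (y, x) => //; rewrite /aff /= addrAC.
have vu : angle v u = alpha.
  by rewrite -uv /angle [enorm v * _]mulrC /dot [v.1 * _]mulrC [v.2 * _]mulrC.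
by rewrite RaE2 in side *; apply: rhombus_cover_ratio side Dside pqv.
Qed.
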